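(* Let $p\colon\mathbb{E}\to\mathbb{B}$ be a locally small bifibration, where $\mathbb{B}$ has finite limits and each fibre $\mathbb{E}_I$ has pullbacks, pushouts and binary coproducts. Fix a vertical map $m$, and let $(L_1,R_1)$ be step-one of the small object argument on $m$, factoring a vertical map $g\colon Z\to Y$ as $Z\xrightarrow{L_1g}K_1g\xrightarrow{R_1g}Y$. Suppose that for every $Y\in\mathbb{E}$ and every vertical map $f\colon X\to Y$, the following pointed endofunctor on $\mathbb{E}_{p(Y)}/Y$ has an initial algebra: it sends $g\colon Z\to Y$ to $\langle f,R_1g\rangle\colon X\amalg K_1g\to Y$, and its point at $g$ is the composite $Z\xrightarrow{L_1g}K_1g\hookrightarrow X\amalg K_1g$. Then the awfs cofibrantly generated by $m$ exists.
   Context: Fibrations. $p$ is cloven with reindexing $\sigma^*$; a bifibration means $p$ and $p^{op}$ are fibrations. Vertical maps are those sent by $p$ to identities; $\mathbb{E}_I$ is the fibre over $I$. $V(\mathbb{E})$ is the full subcategory of $\mathbb{E}^{\mathbf 2}$ on vertical maps, with $\mathrm{dom},\mathrm{cod}\colon V(\mathbb{E})\to\mathbb{E}$; it is fibred over $\mathbb{B}$ via $p\circ\mathrm{dom}=p\circ\mathrm{cod}$. $p$ is locally small if for all $X,Y\in\mathbb{E}_I$ the functor $(u\colon J\to I)\mapsto\mathbb{E}_J(u^*X,u^*Y)$ on $(\mathbb{B}/I)^{op}$ is representable. An algebra for a pointed endofunctor $(T,\eta)$ is $(A,\alpha\colon TA\to A)$ with $\alpha\circ\eta_A=1$; an initial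 algebra is an initial object of the category of such algebras. ''Over $\mathrm{cod}$'' (resp. $\mathrm{dom}$) means commuting with $\mathrm{cod}$ (resp. $\mathrm{dom}$), with structural transformations having identity codomain (resp. domain) components. Factorisations. A functorial factorisation over $\mathbb{B}$ functorially factors each vertical $f\colon X\to Y$ as $X\xrightarrow{Lf}Kf\xrightarrow{Rf}Y$ with both maps vertical (over $\mathbb{B}$). $R$ is then a pointed endofunctor over $\mathrm{cod}$ with unit $\lambda_f=(Lf,1_Y)$ and $L$ a copointed endofunctor over $\mathrm{dom}$ with counit $(1_X,Rf)$. An lawfs adds $\Sigma\colon L\Rightarrow L^2$ making $L$ a comonad over $\mathrm{dom}$. An awfs adds such a $\Sigma$ and $\Pi\colon R^2\Rightarrow R$ making $R$ a monad over $\mathrm{cod}$, such that the canonical transformation $LR\Rightarrow RL$ (component at $f$: domain part the codomain component $Kf\to KLf$ of $\Sigma_f$; codomain part the domain component $KRf\to Kf$ of $\Pi_f$) is a distributive law. Algebraically free. A morphism of lawfs's is a natural transformation of factorisation functors given by vertical maps $Kf\to K'f$ (identity on domain and codomain of $f$) respecting comultiplication; it induces a functor $(R',\lambda')\text{-Alg}\to(R,\lambda)\text{-Alg}$ on pointed endofunctor algebras. An awfs $(L',R')$ is algebraically free on an lawfs $(L,R)$ if it is equipped with a morphism of lawfs's $(L,R)\to(L',R')$ such that the composite of the forgetful functor $(R',\lambda',\Pi')\text{-Alg}\to(R',\lambda')\text{-Alg}$ (from monad algebras) with the induced functor $(R',\lambda')\text{-Alg}\to(R,\lambda)\text{-Alg}$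 is an isomorphism. The awfs cofibrantly generated by $m$ is the awfs algebraically free on step-one $(L_1,R_1)$. Step-one. Let $m$ be vertical over $I$. For $f$ vertical over $J$ let $(\underline{\mathrm{Hom}}(m,f),\sigma_f,\tau_f,h_f\colon\sigma_f^*(m)\to f)$, with $\sigma_f$, $\tau_f$ maps from $\underline{\mathrm{Hom}}(m,f)$ to $I$, $J$ and $h_f$ in $V(\mathbb{E})$ over $\tau_f$, be universal: every $(K,\sigma,\tau,h\colon\sigma^*(m)\to f\text{ over }\tau)$ is $(\sigma_ft,\tau_ft,h_f\circ c)$ for a unique $t\colon K\to\underline{\mathrm{Hom}}(m,f)$, $c$ the canonical cartesian map over $t$. Factor $h_f=\epsilon_f\circ k_f$ with $k_f\colon\sigma_f^*(m)\to L_1f$ opcartesian over $\mathrm{dom}\colon V(\mathbb{E})\to\mathbb{E}$ (an opfibration here) and $\epsilon_f$ having identity domain component. $R_1f$ is the codomain component of $\epsilon_f$. The comultiplication $\Sigma_f$ is the unique map with identity domain component with $\Sigma_fk_f=k_{L_1f}s$, where $s\colon\sigma_f^*(m)\to\sigma_{L_1f}^*(m)$ is the map compatible with the cartesian maps to $m$ with $h_{L_1f}s=k_f$. *)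

(* Defs.v *)
(* Elementary category theory over plain Rocq/Stdlib: hom-sets are types with
   Leibniz equality, and universal properties are stated in Prop with exists!. *)
From Corelib Require Import ssreflect.
From Stdlib Require Import List ProofIrrelevance FunctionalExtensionality.
From Stdlib Require Import ClassicalEpsilon.

Set Implicit Arguments.
Unset Strict Implicit.
Unset Printing Implicit Defensive.

Definition the (T : Type) (P : T -> Prop) (H : exists! x, P x) : T :=
  proj1_sig (constructive_definite_description P H).

Lemma the_spec (T : Type) (P : T -> Prop) (H : exists! x, P x) : P (the H).
Proof. exact (proj2_sig (constructive_definite_description P H)). Qed.

Lemma the_unique (T : Type) (P : T -> Prop) (H : exists! x, P x) (y : T) :
  P y -> the H = y.
Proof. have [x [_ Hx]] : exists! x, P x by exact: H.
by move=> Hy; rewrite -(Hx _ Hy) -(Hx _ (the_spec H)). Qed.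

Lemma exists_unique_eq (T : Type) (P : T -> Prop) (H : exists! x, P x) (y z : T) :
  P y -> P z -> y = z.
Proof. by move=> Py Pz; rewrite -(the_unique H Py) (the_unique H Pz). Qed.

Declare Scope cat_scope.
Delimit Scope cat_scope with cat.
Local Open Scope cat_scope.

Record Category := {
  Ob :> Type;
  Hom : Ob -> Ob -> Type;
  idm : forall X, Hom X X;
  comp : forall X Y Z, Hom Y Z -> Hom X Y -> Hom X Z;
  comp_idl : forall X Y (f : Hom X Y), comp (idm Y) f = f;
  comp_idr : forall X Y (f : Hom X Y), comp f (idm X) = f;
  comp_assoc : forall W X Y Z (h : Hom Y Z) (g : Hom X Y) (f : Hom W X),
    comp h (comp g f) = comp (comp h g) f }.
Arguments Hom {_}.
Arguments idm {_}.
Arguments comp {_ _ _ _}.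
Notation "g ∘ f" := (comp g f) (at level 40, left associativity) : cat_scope.

Definition op (C : Category) : Category.
Proof.
by refine {| Ob := Ob C; Hom := fun X Y => @Hom C Y X; idm := @idm C;
  comp := fun X Y Z g f => @comp C Z Y X f g |};
  move=> *; rewrite ?comp_idl ?comp_idr ?comp_assoc.
Defined.

Record Functor (C D : Category) := {
  fob :> C -> D;
  fmap : forall X Y, Hom X Y -> Hom (fob X) (fob Y);
  fmap_id : forall X, fmap (idm X) = idm (fob X);
  fmap_comp : forall X Y Z (g : Hom Y Z) (f : Hom X Y),
    fmap (g ∘ f) = fmap g ∘ fmap f }.
Arguments fmap {_ _} _ {_ _}.

Definition op_functor (C D : Category) (F : Functor C D) :
  Functor (op C) (op D).
Proof.
refine {| fob := F : op C -> op D; fmap := fun X Y f => @fmap _ _ F Y X f |}.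
- exact (fmap_id F).
- by move=> X Y Z g f; exact: (fmap_comp F).
Defined.

Definition id_functor (C : Category) : Functor C C.
Proof. by refine {| fob := fun X => X; fmap := fun X Y f => f |}. Defined.

Definition comp_functor (C D E : Category) (G : Functor D E) (F : Functor C D) :
  Functor C E.
Proof.
by refine {| fob := fun X => G (F X); fmap := fun X Y f => fmap G (fmap F f) |};
  move=> *; rewrite ?fmap_id ?fmap_comp.
Defined.

Record NatTrans (C D : Category) (F G : Functor C D) := {
  nt :> forall X, Hom (F X) (G X);
  nt_nat : forall X Y (f : Hom X Y), nt Y ∘ fmap F f = fmap G f ∘ nt X }.

Definition IsIsoOfCategories (C D : Category) (F : Functor C D) : Prop :=
  exists G : Functor D C,
    comp_functor G F = id_functor C /\ comp_functor F G = id_functor D.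

Definition IsInitial (C : Category) (X : C) : Prop :=
  forall Y : C, exists! f : Hom X Y, True.

(** [Over] and [Vertical] below compare morphisms whose end points agree only
    propositionally. *)
Inductive HomEq (C : Category) (A B : C) (f : Hom A B) :
  forall A' B' : C, Hom A' B' -> Prop :=
| HomEq_refl : @HomEq C A B f A B f.
Arguments HomEq {C A B} f {A' B'}.

Lemma HomEq_elim (C : Category) (A B A' B' : C) (f : Hom A B) (g : Hom A' B') :
  HomEq f g -> exists (eA : A = A') (eB : B = B'),
    g = eq_rect A (fun A => Hom A B') (eq_rect B (Hom A) f B' eB) A' eA.
Proof. by move=> h; destruct h; exists eq_refl, eq_refl. Qed.

Lemma HomEq_eq (C : Category) (A B : C) (f g : Hom A B) : HomEq f g -> f = g.
Proof.
case/HomEq_elim=> eA [eB ->].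
by rewrite (proof_irrelevance _ eA eq_refl) (proof_irrelevance _ eB eq_refl).
Qed.

Lemma HomEq_sym (C : Category) (A B A' B' : C) (f : Hom A B) (g : Hom A' B') :
  HomEq f g -> HomEq g f.
Proof. by move=> h; destruct h. Qed.

Lemma HomEq_trans (C : Category) (A B A' B' A'' B'' : C)
  (f : Hom A B) (g : Hom A' B') (h : Hom A'' B'') :
  HomEq f g -> HomEq g h -> HomEq f h.
Proof. by move=> e1 e2; destruct e2. Qed.

Lemma HomEq_comp (C : Category) (A B D A' B' D' : C)
  (f : Hom A B) (g : Hom B D) (f' : Hom A' B') (g' : Hom B' D') :
  HomEq f f' -> HomEq g g' -> HomEq (g ∘ f) (g' ∘ f').
Proof.
move=> e; destruct e; move=> /HomEq_elim [eA [eB ->]].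
by rewrite (proof_irrelevance _ eA eq_refl) /=; destruct eB.
Qed.

Lemma HomEq_dom (C : Category) (A B A' B' : C) (f : Hom A B) (g : Hom A' B') :
  HomEq f g -> A = A'.
Proof. by move=> h; destruct h. Qed.

Lemma HomEq_cod (C : Category) (A B A' B' : C) (f : Hom A B) (g : Hom A' B') :
  HomEq f g -> B = B'.
Proof. by move=> h; destruct h. Qed.

Lemma HomEq_id (C : Category) (A B : C) : A = B -> HomEq (idm A) (idm B).
Proof. by move=> e; destruct e. Qed.

Definition FiniteType (T : Type) : Prop := exists l : list T, forall x, In x l.

Definition IsLimit (J C : Category) (D : Functor J C) (A : C)
    (pr : forall j, Hom A (D j)) : Prop :=
  (forall i j (a : Hom i j), fmap D a ∘ pr i = pr j) /\
  forall (Z : C) (q : forall j, Hom Z (D j)),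
    (forall i j (a : Hom i j), fmap D a ∘ q i = q j) ->
    exists! h : Hom Z A, forall j, pr j ∘ h = q j.

Definition HasFiniteLimits (C : Category) : Prop :=
  forall J : Category, FiniteType J -> (forall i j : J, FiniteType (Hom i j)) ->
  forall D : Functor J C, exists A (pr : forall j, Hom A (D j)), IsLimit pr.

Definition IsPullback (C : Category) (P A B D : C) (p1 : Hom P A) (p2 : Hom P B)
    (a : Hom A D) (b : Hom B D) : Prop :=
  a ∘ p1 = b ∘ p2 /\
  forall (Z : C) (q1 : Hom Z A) (q2 : Hom Z B), a ∘ q1 = b ∘ q2 ->
    exists! h : Hom Z P, p1 ∘ h = q1 /\ p2 ∘ h = q2.

Definition HasPullbacks (C : Category) : Prop :=
  forall (A B D : C) (a : Hom A D) (b : Hom B D),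
  exists (P : C) (p1 : Hom P A) (p2 : Hom P B), IsPullback p1 p2 a b.

Definition HasPushouts (C : Category) : Prop := HasPullbacks (op C).

(** Binary coproducts are carried as a choice, because an endofunctor is built
    from them below. *)
Record BinaryCoproducts (C : Category) := {
  cop : C -> C -> C;
  cop_inl : forall A B, Hom A (cop A B);
  cop_inr : forall A B, Hom B (cop A B);
  cop_univ : forall A B Z (a : Hom A Z) (b : Hom B Z),
    exists! h : Hom (cop A B) Z, h ∘ cop_inl A B = a /\ h ∘ cop_inr A B = b }.
Arguments cop_inl {_} _ A B.
Arguments cop_inr {_} _ A B.

Definition copair (C : Category) (S : BinaryCoproducts C) (A B Z : C)
  (a : Hom A Z) (b : Hom B Z) : Hom (cop S A B) Z := the (cop_univ S a b).

Lemma copair_inl (C : Category) (S : BinaryCoproducts C) (A B Z : C)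
  (a : Hom A Z) (b : Hom B Z) : copair S a b ∘ cop_inl S A B = a.
Proof. exact (proj1 (the_spec (cop_univ S a b))). Qed.

Lemma copair_inr (C : Category) (S : BinaryCoproducts C) (A B Z : C)
  (a : Hom A Z) (b : Hom B Z) : copair S a b ∘ cop_inr S A B = b.
Proof. exact (proj2 (the_spec (cop_univ S a b))). Qed.

Lemma cop_ext (C : Category) (S : BinaryCoproducts C) (A B Z : C)
  (h h' : Hom (cop S A B) Z) : h ∘ cop_inl S A B = h' ∘ cop_inl S A B ->
  h ∘ cop_inr S A B = h' ∘ cop_inr S A B -> h = h'.
Proof.
move=> e1 e2.
exact: (exists_unique_eq (cop_univ S (h' ∘ cop_inl S A B) (h' ∘ cop_inr S A B))).
Qed.

Lemma copair_post (C : Category) (S : BinaryCoproducts C) (A B Z Z' : C)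
  (h : Hom Z Z') (a : Hom A Z) (b : Hom B Z) :
  h ∘ copair S a b = copair S (h ∘ a) (h ∘ b).
Proof. by apply: cop_ext; rewrite -comp_assoc ?copair_inl ?copair_inr. Qed.

Lemma copair_id (C : Category) (S : BinaryCoproducts C) (A B : C) :
  copair S (cop_inl S A B) (cop_inr S A B) = idm (cop S A B).
Proof. by apply: cop_ext; rewrite ?copair_inl ?copair_inr comp_idl. Qed.

Record SliceOb (C : Category) (Y : C) := { sl_ob : C; sl_map : Hom sl_ob Y }.
Arguments sl_ob {_ _}.
Arguments sl_map {_ _}.

Record SliceHom (C : Category) (Y : C) (g g' : SliceOb Y) := {
  sh_map : Hom (sl_ob g) (sl_ob g');
  sh_comm : sl_map g' ∘ sh_map = sl_map g }.
Arguments sh_map {_ _ _ _}.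

Lemma SliceHom_ext (C : Category) (Y : C) (g g' : SliceOb Y)
  (a b : SliceHom g g') : sh_map a = sh_map b -> a = b.
Proof.
by case: a b => a ea [b eb] /= e; subst b; rewrite (proof_irrelevance _ ea eb).
Qed.

Definition Slice (C : Category) (Y : C) : Category.
Proof.
unshelve refine {| Ob := SliceOb Y; Hom := @SliceHom C Y;
  idm := fun g => {| sh_map := idm (sl_ob g) |};
  comp := fun g g' g'' b a => {| sh_map := sh_map b ∘ sh_map a |} |}.
- exact: comp_idr.
- by rewrite comp_assoc !sh_comm.
- by move=> *; apply: SliceHom_ext; rewrite /= comp_idl.
- by move=> *; apply: SliceHom_ext; rewrite /= comp_idr.
- by move=> *; apply: SliceHom_ext; rewrite /= comp_assoc.
Defined.

Definition Sets : Category.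
Proof.
by refine {| Ob := Type; Hom := fun A B => A -> B; idm := fun A x => x;
  comp := fun A B D g f x => g (f x) |}.
Defined.

Definition yoneda (C : Category) (A : C) : Functor (op C) Sets.
Proof.
refine {| fob := fun Z : op C => @Hom C Z A : Sets;
  fmap := fun (X Y : op C) (t : @Hom C Y X) (x : @Hom C X A) => x ∘ t |}.
- by move=> X; apply: functional_extensionality => x; exact: comp_idr.
- by move=> X Y Z g f; apply: functional_extensionality => x; exact: comp_assoc.
Defined.

Definition IsRepresentable (C : Category) (F : Functor (op C) Sets) : Prop :=
  exists (A : C) (a : NatTrans (yoneda A) F) (b : NatTrans F (yoneda A)),
  forall Z, (forall x, b Z (a Z x) = x) /\ (forall y, a Z (b Z y) = y).

Definition IsMonad (C : Category) (T : Functor C C)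
    (eta : NatTrans (id_functor C) T) (mu : NatTrans (comp_functor T T) T) : Prop :=
  (forall A, mu A ∘ eta (T A) = idm (T A))
  /\ (forall A, mu A ∘ fmap T (eta A) = idm (T A))
  /\ (forall A, mu A ∘ mu (T A) = mu A ∘ fmap T (mu A)).

Definition IsComonad (C : Category) (T : Functor C C)
    (eps : NatTrans T (id_functor C)) (del : NatTrans T (comp_functor T T)) : Prop :=
  (forall A, eps (T A) ∘ del A = idm (T A))
  /\ (forall A, fmap T (eps A) ∘ del A = idm (T A))
  /\ (forall A, del (T A) ∘ del A = fmap T (del A) ∘ del A).

Definition IsDistributiveLaw (C : Category) (G T : Functor C C)
    (eps : NatTrans G (id_functor C)) (del : NatTrans G (comp_functor G G))
    (eta : NatTrans (id_functor C) T) (mu : NatTrans (comp_functor T T) T)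
    (d : NatTrans (comp_functor G T) (comp_functor T G)) : Prop :=
  (forall A, d A ∘ fmap G (eta A) = eta (G A))
  /\ (forall A, d A ∘ fmap G (mu A) = mu (G A) ∘ fmap T (d A) ∘ d (T A))
  /\ (forall A, fmap T (eps A) ∘ d A = eps (T A))
  /\ (forall A, fmap T (del A) ∘ d A = d (G A) ∘ fmap G (d A) ∘ del (T A)).

Record PAlgOb (C : Category) (T : Functor C C) (eta : NatTrans (id_functor C) T) := {
  pa_ob : C;
  pa_str : Hom (T pa_ob) pa_ob;
  pa_unit : pa_str ∘ eta pa_ob = idm pa_ob }.
Arguments pa_ob {_ _ _}.
Arguments pa_str {_ _ _}.

Record PAlgHom (C : Category) (T : Functor C C) (eta : NatTrans (id_functor C) T)
  (A B : PAlgOb eta) := {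
  ph_map : Hom (pa_ob A) (pa_ob B);
  ph_comm : ph_map ∘ pa_str A = pa_str B ∘ fmap T ph_map }.
Arguments ph_map {_ _ _ _ _}.

Lemma PAlgHom_ext (C : Category) (T : Functor C C) (eta : NatTrans (id_functor C) T)
  (A B : PAlgOb eta) (a b : PAlgHom A B) : ph_map a = ph_map b -> a = b.
Proof.
by case: a b => a ea [b eb] /= e; subst b; rewrite (proof_irrelevance _ ea eb).
Qed.

Definition PAlg (C : Category) (T : Functor C C) (eta : NatTrans (id_functor C) T) :
  Category.
Proof.
unshelve refine {| Ob := PAlgOb eta; Hom := @PAlgHom C T eta;
  idm := fun A => {| ph_map := idm (pa_ob A) |};
  comp := fun A B D b a => {| ph_map := ph_map b ∘ ph_map a |} |}.
- by rewrite fmap_id comp_idl comp_idr.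
- by rewrite fmap_comp -comp_assoc ph_comm comp_assoc ph_comm comp_assoc.
- by move=> *; apply: PAlgHom_ext; rewrite /= comp_idl.
- by move=> *; apply: PAlgHom_ext; rewrite /= comp_idr.
- by move=> *; apply: PAlgHom_ext; rewrite /= comp_assoc.
Defined.

Record MAlgOb (C : Category) (T : Functor C C) (eta : NatTrans (id_functor C) T)
  (mu : NatTrans (comp_functor T T) T) := {
  ma_palg : PAlgOb eta;
  ma_assoc : pa_str ma_palg ∘ mu (pa_ob ma_palg)
             = pa_str ma_palg ∘ fmap T (pa_str ma_palg) }.
Arguments ma_palg {_ _ _ _}.

Definition MAlg (C : Category) (T : Functor C C) (eta : NatTrans (id_functor C) T)
  (mu : NatTrans (comp_functor T T) T) : Category.
Proof.
refine {| Ob := MAlgOb eta mu;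
  Hom := fun A B => @Hom (PAlg eta) (ma_palg A) (ma_palg B);
  idm := fun A => @idm (PAlg eta) (ma_palg A);
  comp := fun A B D b a => @comp (PAlg eta) _ _ _ b a |}.
- by move=> A B; exact: (@comp_idl (PAlg eta)).
- by move=> A B; exact: (@comp_idr (PAlg eta)).
- by move=> A B D E; exact: (@comp_assoc (PAlg eta)).
Defined.

Definition MAlg_forget (C : Category) (T : Functor C C)
  (eta : NatTrans (id_functor C) T) (mu : NatTrans (comp_functor T T) T) :
  Functor (MAlg eta mu) (PAlg eta).
Proof.
by refine {| fob := fun A : MAlg eta mu => ma_palg A : PAlg eta;
  fmap := fun A B a => a |}.
Defined.

Definition PAlg_induced_ob (C : Category) (T T' : Functor C C)
  (eta : NatTrans (id_functor C) T) (eta' : NatTrans (id_functor C) T')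
  (r : NatTrans T T') (Hr : forall A, r A ∘ eta A = eta' A) (A : PAlgOb eta') :
  PAlgOb eta.
Proof.
refine {| pa_ob := pa_ob A; pa_str := pa_str A ∘ r (pa_ob A) |}.
by rewrite -comp_assoc Hr pa_unit.
Defined.

Definition PAlg_induced (C : Category) (T T' : Functor C C)
  (eta : NatTrans (id_functor C) T) (eta' : NatTrans (id_functor C) T')
  (r : NatTrans T T') (Hr : forall A, r A ∘ eta A = eta' A) :
  Functor (PAlg eta') (PAlg eta).
Proof.
unshelve refine {| fob := PAlg_induced_ob Hr : PAlg eta' -> PAlg eta;
  fmap := fun (A B : PAlg eta') (a : PAlgHom A B) =>
    {| ph_map := ph_map a : Hom (pa_ob (PAlg_induced_ob Hr A))
                                (pa_ob (PAlg_induced_ob Hr B)) |} |}.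
- by rewrite /= comp_assoc ph_comm -!comp_assoc nt_nat.
- by move=> A; apply: PAlgHom_ext.
- by move=> *; apply: PAlgHom_ext.
Defined.

Definition Over (E B : Category) (p : Functor E B) (X Y : E) (f : Hom X Y)
  (J I : B) (u : Hom J I) : Prop := HomEq (fmap p f) u.

Definition Cartesian (E B : Category) (p : Functor E B) (X Y : E) (f : Hom X Y) : Prop :=
  forall (Z : E) (g : Hom Z Y) (w : Hom (p Z) (p X)), fmap p f ∘ w = fmap p g ->
  exists! h : Hom Z X, fmap p h = w /\ f ∘ h = g.

Definition Opcartesian (E B : Category) (p : Functor E B) (X Y : E) (f : Hom X Y) : Prop :=
  @Cartesian (op E) (op B) (op_functor p) Y X f.

Definition IsFibration (E B : Category) (p : Functor E B) : Prop :=
  forall (I : B) (Y : E) (u : Hom I (p Y)),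
  exists (X : E) (f : Hom X Y), Over p f u /\ Cartesian p f.

Definition IsBifibration (E B : Category) (p : Functor E B) : Prop :=
  IsFibration p /\ IsFibration (op_functor p).

Definition Vertical (E B : Category) (p : Functor E B) (X Y : E) (f : Hom X Y) : Prop :=
  exists I : B, Over p f (idm I).

Lemma Over_eq (E B : Category) (p : Functor E B) (X Y : E) (f : Hom X Y)
  (J I : B) (u : Hom J I) : Over p f u ->
  forall J' I' (u' : Hom J' I'), Over p f u' -> HomEq u u'.
Proof. by move=> h J' I' u'; apply: HomEq_trans; apply: HomEq_sym. Qed.

Lemma Over_id (E B : Category) (p : Functor E B) (X : E) (I : B) :
  p X = I -> Over p (idm X) (idm I).
Proof. by move=> e; subst I; rewrite /Over fmap_id. Qed.

Lemma Over_comp (E B : Category) (p : Functor E B) (X Y Z : E) (f : Hom X Y)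
  (g : Hom Y Z) (K J I : B) (u : Hom K J) (v : Hom J I) :
  Over p f u -> Over p g v -> Over p (g ∘ f) (v ∘ u).
Proof. by rewrite /Over fmap_comp; exact: HomEq_comp. Qed.

Lemma Over_comp_eq (E B : Category) (p : Functor E B) (X Y Z : E) (f : Hom X Y)
  (g : Hom Y Z) (K J I : B) (u : Hom K J) (v : Hom J I) (w : Hom K I) :
  v ∘ u = w -> Over p f u -> Over p g v -> Over p (g ∘ f) w.
Proof. by move=> <-; exact: Over_comp. Qed.

Lemma Over_idl (E B : Category) (p : Functor E B) (X Y Z : E) (f : Hom X Y)
  (g : Hom Y Z) (J I : B) (u : Hom J I) :
  Over p f u -> Over p g (idm I) -> Over p (g ∘ f) u.
Proof. by move=> hf hg; rewrite -(comp_idl u); exact: Over_comp. Qed.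

Lemma Over_idr (E B : Category) (p : Functor E B) (X Y Z : E) (f : Hom X Y)
  (g : Hom Y Z) (J I : B) (u : Hom J I) :
  Over p f (idm J) -> Over p g u -> Over p (g ∘ f) u.
Proof. by move=> hf hg; rewrite -(comp_idr u); exact: Over_comp. Qed.

Lemma Vertical_over (E B : Category) (p : Functor E B) (X Y : E) (f : Hom X Y) (I : B) :
  Vertical p f -> p X = I -> Over p f (idm I).
Proof. by case=> J h e; move: (HomEq_dom h); rewrite e => ->. Qed.

Lemma Vertical_base (E B : Category) (p : Functor E B) (X Y : E) (f : Hom X Y) :
  Vertical p f -> p Y = p X.
Proof. by case=> J h; rewrite (HomEq_dom h) (HomEq_cod h). Qed.

Lemma cartesian_over (E B : Category) (p : Functor E B) (X Y Z : E)
  (f : Hom X Y) (g : Hom Z Y) (I J K : B) (u : Hom J I) (v : Hom K I) (t : Hom K J) :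
  Cartesian p f -> Over p f u -> Over p g v -> u ∘ t = v ->
  exists! h : Hom Z X, Over p h t /\ f ∘ h = g.
Proof.
move=> cf hu hv ht; rewrite /Over in hu hv.
destruct hu.
have eK : p Z = K by exact: HomEq_dom hv.
subst K; rewrite -(HomEq_eq hv) in ht.
have [h [[h1 h2] hU]] := cf _ _ _ ht.
exists h; split; first by split; [rewrite /Over h1 | ].
by move=> h' [/HomEq_eq e1 e2]; exact: hU.
Qed.

Record FibOb (E B : Category) (p : Functor E B) (I : B) := {
  fib_ob :> E;
  fib_eq : p fib_ob = I }.

Record FibHom (E B : Category) (p : Functor E B) (I : B) (X Y : FibOb p I) := {
  fh_map : Hom (fib_ob X) (fib_ob Y);
  fh_over : Over p fh_map (idm I) }.
Arguments fh_map {_ _ _ _ _ _}.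

Lemma FibHom_ext (E B : Category) (p : Functor E B) (I : B) (X Y : FibOb p I)
  (a b : FibHom X Y) : fh_map a = fh_map b -> a = b.
Proof.
by case: a b => a ea [b eb] /= e; subst b; rewrite (proof_irrelevance _ ea eb).
Qed.

Definition Fibre (E B : Category) (p : Functor E B) (I : B) : Category.
Proof.
unshelve refine {| Ob := FibOb p I; Hom := @FibHom E B p I;
  idm := fun X => {| fh_map := idm (fib_ob X) |};
  comp := fun X Y Z b a => {| fh_map := fh_map b ∘ fh_map a |} |}.
- exact: Over_id (fib_eq X).
- exact: Over_idl (fh_over a) (fh_over b).
- by move=> *; apply: FibHom_ext; rewrite /= comp_idl.
- by move=> *; apply: FibHom_ext; rewrite /= comp_idr.
- by move=> *; apply: FibHom_ext; rewrite /= comp_assoc.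
Defined.

Record Cleavage (E B : Category) (p : Functor E B) := {
  reindex : forall (J I : B) (u : Hom J I), FibOb p I -> FibOb p J;
  lift : forall (J I : B) (u : Hom J I) (X : FibOb p I),
    Hom (fib_ob (reindex u X)) (fib_ob X);
  lift_over : forall (J I : B) (u : Hom J I) (X : FibOb p I), Over p (lift u X) u;
  lift_cartesian : forall (J I : B) (u : Hom J I) (X : FibOb p I),
    Cartesian p (lift u X) }.
Arguments reindex {_ _ _} _ {_ _}.
Arguments lift {_ _ _} _ {_ _}.
Arguments lift_over {_ _ _} _ {_ _}.
Arguments lift_cartesian {_ _ _} _ {_ _}.

Lemma reindex_comparison_unique (E B : Category) (p : Functor E B) (cl : Cleavage p)
  (K H I : B) (r : Hom H I) (u : Hom K I) (t : Hom K H) (e : r ∘ t = u)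
  (X : FibOb p I) :
  exists! c : Hom (fib_ob (reindex cl u X)) (fib_ob (reindex cl r X)),
    Over p c t /\ lift cl r X ∘ c = lift cl u X.
Proof.
refine (cartesian_over (lift_cartesian cl r X) (lift_over cl r X) (lift_over cl u X) e).
Qed.

(** The canonical cartesian map [(r ∘ t)^* X -> r^* X] over [t]. *)
Definition reindex_comparison (E B : Category) (p : Functor E B) (cl : Cleavage p)
  (K H I : B) (r : Hom H I) (u : Hom K I) (t : Hom K H) (e : r ∘ t = u)
  (X : FibOb p I) : Hom (fib_ob (reindex cl u X)) (fib_ob (reindex cl r X)) :=
  the (reindex_comparison_unique cl e X).

Lemma restrict_unique (E B : Category) (p : Functor E B) (cl : Cleavage p)
  (K H I : B) (r : Hom H I) (u : Hom K I) (t : Hom K H) (e : r ∘ t = u)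
  (X Y : FibOb p I) (a : FibHom (reindex cl r X) (reindex cl r Y)) :
  exists! b : FibHom (reindex cl u X) (reindex cl u Y),
    reindex_comparison cl e Y ∘ fh_map b = fh_map a ∘ reindex_comparison cl e X.
Proof.
have [oX lX] := the_spec (reindex_comparison_unique cl e X).
have [oY lY] := the_spec (reindex_comparison_unique cl e Y).
rewrite -!/(reindex_comparison _ _ _) in oX lX oY lY.
have o1 : Over p (fh_map a ∘ reindex_comparison cl e X) t by exact: Over_idl oX (fh_over a).
have o2 : Over p (lift cl r Y ∘ (fh_map a ∘ reindex_comparison cl e X)) u.
  by exact: Over_comp_eq e o1 (lift_over cl r Y).
have [b [[ob lb] ub]] := cartesian_over (lift_cartesian cl u Y) (lift_over cl u Y) o2 (comp_idr u).
exists {| fh_map := b; fh_over := ob |}; split => /=.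
- apply: (exists_unique_eq (cartesian_over (lift_cartesian cl r Y) (lift_over cl r Y) o2 e)).
  + by split; [exact: Over_idr ob oY | rewrite comp_assoc lY].
  + by [].
- move=> b' hb'; apply: FibHom_ext => /=; apply: ub; split; first exact: fh_over.
  by rewrite -lY -comp_assoc hb'.
Qed.

(** The presheaf [(u : J -> I) |-> E_J(u^* X, u^* Y)] on [B/I]. *)
Definition hom_presheaf (E B : Category) (p : Functor E B) (cl : Cleavage p)
  (I : B) (X Y : FibOb p I) : Functor (op (Slice I)) Sets.
Proof.
refine {| fob := fun u : op (Slice I) =>
    FibHom (reindex cl (sl_map u) X) (reindex cl (sl_map u) Y) : Sets;
  fmap := fun (r u : op (Slice I)) (t : @Hom (Slice I) u r)
    (a : FibHom (reindex cl (sl_map r) X) (reindex cl (sl_map r) Y)) =>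
    the (restrict_unique (sh_comm t) a) |}.
- move=> u; apply: functional_extensionality => a; apply: the_unique.
  have h Z : reindex_comparison cl (sh_comm (@idm (Slice I) u)) Z = idm _.
    by apply: the_unique; split; [exact: Over_id (fib_eq _) | rewrite comp_idr].
  by rewrite !h comp_idl comp_idr.
- move=> s r u t' t; apply: functional_extensionality => a; apply: the_unique.
  rewrite -/(@comp (Slice I)).
  have h Z : reindex_comparison cl (sh_comm (@comp (op (Slice I)) _ _ _ t' t)) Z
      = reindex_comparison cl (sh_comm t) Z ∘ reindex_comparison cl (sh_comm t') Z.
    have [o1 l1] := the_spec (reindex_comparison_unique cl (sh_comm t) Z).
    have [o2 l2] := the_spec (reindex_comparison_unique cl (sh_comm t') Z).
    apply: the_unique; split; first exact: Over_comp o2 o1.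
    by rewrite comp_assoc l1.
  have e1 := the_spec (restrict_unique (sh_comm t) a).
  have e2 := the_spec (restrict_unique (sh_comm t') (the (restrict_unique (sh_comm t) a))).
  by rewrite !h -comp_assoc e2 comp_assoc e1 comp_assoc.
Defined.

Definition IsLocallySmall (E B : Category) (p : Functor E B) (cl : Cleavage p) : Prop :=
  forall (I : B) (X Y : FibOb p I), IsRepresentable (hom_presheaf cl X Y).

Record VOb (E B : Category) (p : Functor E B) := {
  vdom : E;
  vcod : E;
  vmap : Hom vdom vcod;
  vvert : Vertical p vmap }.
Arguments vdom {_ _ _}.
Arguments vcod {_ _ _}.
Arguments vmap {_ _ _}.

Record VHom (E B : Category) (p : Functor E B) (f g : VOb p) := {
  vh_dom : Hom (vdom f) (vdom g);
  vh_cod : Hom (vcod f) (vcod g);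
  vh_comm : vmap g ∘ vh_dom = vh_cod ∘ vmap f }.
Arguments vh_dom {_ _ _ _ _}.
Arguments vh_cod {_ _ _ _ _}.

Lemma VHom_ext (E B : Category) (p : Functor E B) (f g : VOb p) (a b : VHom f g) :
  vh_dom a = vh_dom b -> vh_cod a = vh_cod b -> a = b.
Proof.
case: a b => a0 a1 ea [b0 b1 eb] /= e0 e1.
subst b0 b1.
by rewrite (proof_irrelevance _ ea eb).
Qed.

Definition V (E B : Category) (p : Functor E B) : Category.
Proof.
unshelve refine {| Ob := VOb p; Hom := @VHom E B p;
  idm := fun f => {| vh_dom := idm (vdom f); vh_cod := idm (vcod f) |};
  comp := fun f g h b a => {| vh_dom := vh_dom b ∘ vh_dom a;
                              vh_cod := vh_cod b ∘ vh_cod a |} |}.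
- by rewrite comp_idl comp_idr.
- by rewrite comp_assoc vh_comm -comp_assoc vh_comm comp_assoc.
- by move=> *; apply: VHom_ext; rewrite /= comp_idl.
- by move=> *; apply: VHom_ext; rewrite /= comp_idr.
- by move=> *; apply: VHom_ext; rewrite /= comp_assoc.
Defined.

Definition dom_functor (E B : Category) (p : Functor E B) : Functor (V p) E.
Proof. by refine {| fob := fun f : V p => vdom f; fmap := fun f g a => vh_dom a |}. Defined.

Definition cod_functor (E B : Category) (p : Functor E B) : Functor (V p) E.
Proof. by refine {| fob := fun f : V p => vcod f; fmap := fun f g a => vh_cod a |}. Defined.

Definition vbase_functor (E B : Category) (p : Functor E B) : Functor (V p) B :=
  comp_functor p (dom_functor p).

Definition vbase (E B : Category) (p : Functor E B) (f : VOb p) : B := vbase_functor p f.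

(** The codomain component then lies over the same map, since objects of [V p]
    are vertical. *)
Definition VOver (E B : Category) (p : Functor E B) (f g : VOb p) (a : VHom f g)
  (J I : B) (u : Hom J I) : Prop := @Over (V p) B (vbase_functor p) f g a J I u.

Definition fib_dom (E B : Category) (p : Functor E B) (f : VOb p) : FibOb p (vbase f) :=
  {| fib_ob := vdom f; fib_eq := eq_refl |}.

Definition fib_cod (E B : Category) (p : Functor E B) (f : VOb p) : FibOb p (vbase f) :=
  {| fib_ob := vcod f; fib_eq := Vertical_base (vvert f) |}.

Lemma vreindex_unique (E B : Category) (p : Functor E B) (cl : Cleavage p)
  (m : VOb p) (K : B) (s : Hom K (vbase m)) :
  exists! a : Hom (fib_ob (reindex cl s (fib_dom m))) (fib_ob (reindex cl s (fib_cod m))),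
    Over p a (idm K) /\ lift cl s (fib_cod m) ∘ a = vmap m ∘ lift cl s (fib_dom m).
Proof.
apply: cartesian_over (lift_cartesian _ _ _) (lift_over _ _ _) _ (comp_idr s).
exact: Over_idl (lift_over cl s (fib_dom m)) (Vertical_over (vvert m) eq_refl).
Qed.

(** The reindexing [s^*(m)] of a vertical map, with its cartesian map to [m]. *)
Definition vreindex (E B : Category) (p : Functor E B) (cl : Cleavage p)
  (m : VOb p) (K : B) (s : Hom K (vbase m)) : VOb p :=
  {| vdom := reindex cl s (fib_dom m);
     vcod := reindex cl s (fib_cod m);
     vmap := the (vreindex_unique cl s);
     vvert := ex_intro _ K (proj1 (the_spec (vreindex_unique cl s))) |}.

Definition vlift (E B : Category) (p : Functor E B) (cl : Cleavage p)
  (m : VOb p) (K : B) (s : Hom K (vbase m)) : VHom (vreindex cl s) m :=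
  @Build_VHom E B p (vreindex cl s) m (lift cl s (fib_dom m)) (lift cl s (fib_cod m))
    (eq_sym (proj2 (the_spec (vreindex_unique cl s)))).

Lemma vreindex_comparison_comm (E B : Category) (p : Functor E B) (cl : Cleavage p)
  (m : VOb p) (K H : B) (r : Hom H (vbase m)) (u : Hom K (vbase m)) (t : Hom K H)
  (e : r ∘ t = u) :
  vmap (vreindex cl r) ∘ reindex_comparison cl e (fib_dom m)
  = reindex_comparison cl e (fib_cod m) ∘ vmap (vreindex cl u).
Proof.
have [o0 l0] := the_spec (reindex_comparison_unique cl e (fib_dom m)).
have [o1 l1] := the_spec (reindex_comparison_unique cl e (fib_cod m)).
have [or lr] := the_spec (vreindex_unique cl r).
have [ou lu] := the_spec (vreindex_unique cl u).
have o2 : Over p (lift cl r (fib_cod m) ∘ (reindex_comparison cl e (fib_cod m)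
    ∘ vmap (vreindex cl u))) u.
  by apply: (Over_comp_eq e _ (lift_over cl r (fib_cod m))); exact: Over_idr ou o1.
apply: (exists_unique_eq (cartesian_over (lift_cartesian cl r (fib_cod m))
  (lift_over cl r (fib_cod m)) o2 e)).
- split; first exact: Over_idl o0 or.
  by rewrite !comp_assoc l1 lr lu -comp_assoc l0.
- by split; first exact: Over_idr ou o1.
Qed.

(** The canonical cartesian map [(r ∘ t)^* m -> r^* m] of [V(E)] over [t]. *)
Definition vreindex_comparison (E B : Category) (p : Functor E B) (cl : Cleavage p)
  (m : VOb p) (K H : B) (r : Hom H (vbase m)) (u : Hom K (vbase m)) (t : Hom K H)
  (e : r ∘ t = u) : VHom (vreindex cl u) (vreindex cl r) :=
  @Build_VHom E B p (vreindex cl u) (vreindex cl r)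
    (reindex_comparison cl e (fib_dom m)) (reindex_comparison cl e (fib_cod m))
    (vreindex_comparison_comm cl e).

(** That [K] is over [B] follows from the verticality of the components of [L]
    and naturality. *)
Record FunctorialFactorisation (E B : Category) (p : Functor E B) := {
  ffK : Functor (V p) E;
  ffL : NatTrans (dom_functor p) ffK;
  ffR : NatTrans ffK (cod_functor p);
  ffL_vert : forall f, Vertical p (ffL f);
  ffR_vert : forall f, Vertical p (ffR f);
  ff_factor : forall f : V p, ffR f ∘ ffL f = vmap f }.
Arguments ffK {_ _ _}.
Arguments ffL {_ _ _}.
Arguments ffR {_ _ _}.

Definition Lob (E B : Category) (p : Functor E B) (F : FunctorialFactorisation p)
  (f : VOb p) : VOb p := {| vmap := ffL F f; vvert := ffL_vert F f |}.

Definition Rob (E B : Category) (p : Functor E B) (F : FunctorialFactorisation p)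
  (f : VOb p) : VOb p := {| vmap := ffR F f; vvert := ffR_vert F f |}.

Definition Lfun (E B : Category) (p : Functor E B) (F : FunctorialFactorisation p) :
  Functor (V p) (V p).
Proof.
unshelve refine {| fob := Lob F : V p -> V p;
  fmap := fun f g (a : @Hom (V p) f g) =>
    {| vh_dom := vh_dom a : Hom (vdom (Lob F f)) (vdom (Lob F g));
       vh_cod := fmap (ffK F) a : Hom (vcod (Lob F f)) (vcod (Lob F g)) |} |}.
- exact: (nt_nat (ffL F) a).
- by move=> f; apply: VHom_ext => //=; exact: (fmap_id (ffK F)).
- by move=> f g h b a; apply: VHom_ext => //=; exact: (fmap_comp (ffK F)).
Defined.

Definition Rfun (E B : Category) (p : Functor E B) (F : FunctorialFactorisation p) :
  Functor (V p) (V p).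
Proof.
unshelve refine {| fob := Rob F : V p -> V p;
  fmap := fun f g (a : @Hom (V p) f g) =>
    {| vh_dom := fmap (ffK F) a : Hom (vdom (Rob F f)) (vdom (Rob F g));
       vh_cod := vh_cod a : Hom (vcod (Rob F f)) (vcod (Rob F g)) |} |}.
- exact: (nt_nat (ffR F) a).
- by move=> f; apply: VHom_ext => //=; exact: (fmap_id (ffK F)).
- by move=> f g h b a; apply: VHom_ext => //=; exact: (fmap_comp (ffK F)).
Defined.

Definition Rpoint (E B : Category) (p : Functor E B) (F : FunctorialFactorisation p) :
  NatTrans (id_functor (V p)) (Rfun F).
Proof.
unshelve refine {| nt := fun f : V p =>
  {| vh_dom := ffL F f : Hom (vdom f) (vdom (Rob F f));
     vh_cod := idm (vcod f) : Hom (vcod f) (vcod (Rob F f)) |}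
  : @Hom (V p) (id_functor (V p) f) (Rfun F f) |}.
- by rewrite /= comp_idl ff_factor.
- move=> f g a; apply: VHom_ext => /=; first exact: (nt_nat (ffL F) a).
  by rewrite comp_idl comp_idr.
Defined.

Definition Lcopoint (E B : Category) (p : Functor E B) (F : FunctorialFactorisation p) :
  NatTrans (Lfun F) (id_functor (V p)).
Proof.
unshelve refine {| nt := fun f : V p =>
  {| vh_dom := idm (vdom f) : Hom (vdom (Lob F f)) (vdom f);
     vh_cod := ffR F f : Hom (vcod (Lob F f)) (vcod f) |}
  : @Hom (V p) (Lfun F f) (id_functor (V p) f) |}.
- by rewrite /= comp_idr ff_factor.
- move=> f g a; apply: VHom_ext => /=; last exact: (nt_nat (ffR F) a).
  by rewrite comp_idl comp_idr.
Defined.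

Record Lawfs (E B : Category) (p : Functor E B) := {
  lw_ff :> FunctorialFactorisation p;
  lw_Sigma : NatTrans (Lfun lw_ff) (comp_functor (Lfun lw_ff) (Lfun lw_ff));
  lw_Sigma_dom : forall f : V p, vh_dom (lw_Sigma f) = idm (vdom f);
  lw_comonad : IsComonad (Lcopoint lw_ff) lw_Sigma }.
Arguments lw_Sigma {_ _ _}.

(** The canonical transformation [LR => RL]; the square commutes because both
    composites are identities, by a counit and a unit law. *)
Definition canonical_LR_RL (E B : Category) (p : Functor E B) (F : Lawfs p)
  (Pi : NatTrans (comp_functor (Rfun F) (Rfun F)) (Rfun F))
  (HPi : IsMonad (Rpoint F) Pi) :
  NatTrans (comp_functor (Lfun F) (Rfun F)) (comp_functor (Rfun F) (Lfun F)).
Proof.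
unshelve refine {| nt := fun f : V p =>
  {| vh_dom := vh_cod (lw_Sigma F f)
       : Hom (vdom (Lob F (Rob F f))) (vdom (Rob F (Lob F f)));
     vh_cod := vh_dom (Pi f)
       : Hom (vcod (Lob F (Rob F f))) (vcod (Rob F (Lob F f))) |}
  : @Hom (V p) (comp_functor (Lfun F) (Rfun F) f) (comp_functor (Rfun F) (Lfun F) f) |}.
- have [c1 _] := lw_comonad F; have [m1 _] := HPi.
  have h1 := f_equal vh_cod (c1 f); have h2 := f_equal vh_dom (m1 f).
  by rewrite /= in h1 h2 *; rewrite h1 h2.
- move=> f g a; apply: VHom_ext.
  + exact: (f_equal vh_cod (nt_nat (lw_Sigma F) a)).
  + exact: (f_equal vh_dom (nt_nat Pi a)).
Defined.

Record Awfs (E B : Category) (p : Functor E B) := {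
  aw_lawfs :> Lawfs p;
  aw_Pi : NatTrans (comp_functor (Rfun aw_lawfs) (Rfun aw_lawfs)) (Rfun aw_lawfs);
  aw_Pi_cod : forall f : V p, vh_cod (aw_Pi f) = idm (vcod f);
  aw_monad : IsMonad (Rpoint aw_lawfs) aw_Pi;
  aw_distr : IsDistributiveLaw (Lcopoint aw_lawfs) (lw_Sigma aw_lawfs)
    (Rpoint aw_lawfs) aw_Pi (canonical_LR_RL aw_monad) }.
Arguments aw_Pi {_ _ _}.

Record FFHom (E B : Category) (p : Functor E B) (F F' : FunctorialFactorisation p) := {
  ffh :> NatTrans (ffK F) (ffK F');
  ffh_vert : forall f, Vertical p (ffh f);
  ffh_L : forall f, ffh f ∘ ffL F f = ffL F' f;
  ffh_R : forall f, ffR F' f ∘ ffh f = ffR F f }.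

Definition Lhom (E B : Category) (p : Functor E B) (F F' : FunctorialFactorisation p)
  (x : FFHom F F') : NatTrans (Lfun F) (Lfun F').
Proof.
unshelve refine {| nt := fun f : V p =>
  {| vh_dom := idm (vdom f) : Hom (vdom (Lob F f)) (vdom (Lob F' f));
     vh_cod := x f : Hom (vcod (Lob F f)) (vcod (Lob F' f)) |}
  : @Hom (V p) (Lfun F f) (Lfun F' f) |}.
- by rewrite /= comp_idr ffh_L.
- move=> f g a; apply: VHom_ext => /=; last exact: (nt_nat x a).
  by rewrite comp_idl comp_idr.
Defined.

Definition Rhom (E B : Category) (p : Functor E B) (F F' : FunctorialFactorisation p)
  (x : FFHom F F') : NatTrans (Rfun F) (Rfun F').
Proof.
unshelve refine {| nt := fun f : V p =>
  {| vh_dom := x f : Hom (vdom (Rob F f)) (vdom (Rob F' f));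
     vh_cod := idm (vcod f) : Hom (vcod (Rob F f)) (vcod (Rob F' f)) |}
  : @Hom (V p) (Rfun F f) (Rfun F' f) |}.
- by rewrite /= comp_idl ffh_R.
- move=> f g a; apply: VHom_ext => /=; first exact: (nt_nat x a).
  by rewrite comp_idl comp_idr.
Defined.

Lemma Rhom_point (E B : Category) (p : Functor E B) (F F' : FunctorialFactorisation p)
  (x : FFHom F F') (f : V p) : Rhom x f ∘ Rpoint F f = Rpoint F' f.
Proof. by apply: VHom_ext => /=; [exact: ffh_L | exact: comp_idl]. Qed.

Record LawfsHom (E B : Category) (p : Functor E B) (F F' : Lawfs p) := {
  lwh_ff :> FFHom F F';
  lwh_Sigma : forall f : V p,
    lw_Sigma F' f ∘ Lhom lwh_ff f
    = Lhom lwh_ff (Lfun F' f) ∘ fmap (Lfun F) (Lhom lwh_ff f) ∘ lw_Sigma F f }.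

Definition IsAlgebraicallyFreeOn (E B : Category) (p : Functor E B)
    (A : Awfs p) (F : Lawfs p) : Prop :=
  exists x : LawfsHom F A,
    IsIsoOfCategories
      (comp_functor (PAlg_induced (Rhom_point x)) (MAlg_forget (Rpoint A) (aw_Pi A))).

Record UniversalHom (E B : Category) (p : Functor E B) (cl : Cleavage p)
  (m f : VOb p) := {
  uh_ob : B;
  uh_s : Hom uh_ob (vbase m);
  uh_t : Hom uh_ob (vbase f);
  uh_h : VHom (vreindex cl uh_s) f;
  uh_over : VOver uh_h uh_t;
  uh_univ : forall (K : B) (s : Hom K (vbase m)) (t : Hom K (vbase f))
    (h : VHom (vreindex cl s) f), VOver h t ->
    exists! c : Hom K uh_ob,
      uh_t ∘ c = t /\
      exists e : uh_s ∘ c = s, @comp (V p) _ _ _ uh_h (vreindex_comparison cl e) = h }.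
Arguments uh_ob {_ _ _ _ _ _}.
Arguments uh_s {_ _ _ _ _ _}.
Arguments uh_t {_ _ _ _ _ _}.
Arguments uh_h {_ _ _ _ _ _}.

(** Universal objects and factorisations are determined only up to isomorphism;
    this record is a choice of them for every vertical [f].  The functor structure
    and the comultiplication are derived below. *)
Record StepOne (E B : Category) (p : Functor E B) (cl : Cleavage p) (m : VOb p) := {
  so_hom : forall f : VOb p, UniversalHom cl m f;
  so_K : VOb p -> E;
  so_L : forall f : VOb p, Hom (vdom f) (so_K f);
  so_L_vert : forall f, Vertical p (so_L f);
  so_Lob := fun f => {| vmap := so_L f; vvert := so_L_vert f |};
  so_k : forall f, VHom (vreindex cl (uh_s (so_hom f))) (so_Lob f);
  so_eps : forall f, VHom (so_Lob f) f;
  so_k_opcart : forall f,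
    @Opcartesian (V p) E (dom_functor p) (vreindex cl (uh_s (so_hom f))) (so_Lob f) (so_k f);
  so_eps_dom : forall f, vh_dom (so_eps f) = idm (vdom f);
  so_factor : forall f, @comp (V p) _ _ _ (so_eps f) (so_k f) = uh_h (so_hom f) }.
Arguments so_hom {_ _ _ _ _}.
Arguments so_K {_ _ _ _ _}.
Arguments so_L {_ _ _ _ _}.
Arguments so_Lob {_ _ _ _ _}.
Arguments so_k {_ _ _ _ _}.
Arguments so_eps {_ _ _ _ _}.
Arguments so_k_opcart {_ _ _ _ _}.

Lemma Over_ex (E B : Category) (p : Functor E B) (X Y : E) (f : Hom X Y) (J I : B) :
  p X = J -> p Y = I -> exists u : Hom J I, Over p f u.
Proof. by move=> <- <-; exists (fmap p f); exact: HomEq_refl. Qed.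

Lemma vreindex_comparison_lift (E B : Category) (p : Functor E B) (cl : Cleavage p)
  (m : VOb p) (K H : B) (r : Hom H (vbase m)) (u : Hom K (vbase m)) (t : Hom K H)
  (e : r ∘ t = u) :
  @comp (V p) _ _ _ (vlift cl r) (vreindex_comparison cl e) = vlift cl u.
Proof.
apply: VHom_ext.
- exact: (proj2 (the_spec (reindex_comparison_unique cl e (fib_dom m)))).
- exact: (proj2 (the_spec (reindex_comparison_unique cl e (fib_cod m)))).
Qed.

(** A map [s^*(m) -> r^*(m)] compatible with the maps to [m] is canonical. *)
Lemma vreindex_comparison_ex (E B : Category) (p : Functor E B) (cl : Cleavage p)
  (m : VOb p) (K H : B) (r : Hom H (vbase m)) (s : Hom K (vbase m))
  (c : VHom (vreindex cl s) (vreindex cl r)) :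
  @comp (V p) _ _ _ (vlift cl r) c = vlift cl s ->
  exists (w : Hom K H) (e : r ∘ w = s),
    Over p (vh_dom c) w /\ c = vreindex_comparison cl e.
Proof.
move=> hc.
have hd : lift cl r (fib_dom m) ∘ vh_dom c = lift cl s (fib_dom m) by exact: (f_equal vh_dom hc).
have hk : lift cl r (fib_cod m) ∘ vh_cod c = lift cl s (fib_cod m) by exact: (f_equal vh_cod hc).
have ed (K0 : B) (r0 : Hom K0 (vbase m)) X : p (fib_ob (reindex cl r0 X)) = K0 by exact: fib_eq.
have [w ow] := Over_ex (vh_dom c) (ed _ _ _) (ed _ _ _).
have [w' ow'] := Over_ex (vh_cod c) (ed _ _ _) (ed _ _ _).
have e : r ∘ w = s.
  apply: HomEq_eq; apply: (Over_eq _ (lift_over cl s (fib_dom m))).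
  by rewrite -hd; exact: Over_comp ow (lift_over cl r _).
have e' : r ∘ w' = s.
  apply: HomEq_eq; apply: (Over_eq _ (lift_over cl s (fib_cod m))).
  by rewrite -hk; exact: Over_comp ow' (lift_over cl r _).
have ew : w' = w.
  apply: HomEq_eq.
  have o1 : Over p (vh_cod c ∘ vmap (vreindex cl s)) w'.
    exact: Over_idr (proj1 (the_spec (vreindex_unique cl s))) ow'.
  rewrite -(vh_comm c) in o1; apply: Over_eq o1 _ _ _ _.
  exact: Over_idl ow (proj1 (the_spec (vreindex_unique cl r))).
subst w'; exists w, e; split=> //; apply: VHom_ext => /=; symmetry; exact: the_unique.
Qed.

Lemma VOver_comp (E B : Category) (p : Functor E B) (f g h : VOb p) (a : VHom f g)
  (b : VHom g h) (K J I : B) (u : Hom K J) (v : Hom J I) :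
  VOver a u -> VOver b v -> VOver (@comp (V p) _ _ _ b a) (v ∘ u).
Proof. exact: (@Over_comp (V p) B (vbase_functor p)). Qed.

Lemma uh_map_unique (E B : Category) (p : Functor E B) (cl : Cleavage p)
  (m f : VOb p) (H : UniversalHom cl m f) (K : B)
  (s : Hom K (vbase m)) (h : VHom (vreindex cl s) f) :
  exists! c : VHom (vreindex cl s) (vreindex cl (uh_s H)),
    @comp (V p) _ _ _ (vlift cl (uh_s H)) c = vlift cl s
    /\ @comp (V p) _ _ _ (uh_h H) c = h.
Proof.
have [t ot] : exists t : Hom K (vbase f), VOver h t.
  by apply: Over_ex => //; exact: fib_eq.
have [w [[w1 [e ew]] wU]] := uh_univ H ot.
exists (vreindex_comparison cl e); split; first by split; [exact: vreindex_comparison_lift|].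
move=> c [c1 c2].
have [w' [e' [ow' ec]]] := vreindex_comparison_ex c1.
have : w = w'.
  apply: wU; split; last by exists e'; rewrite -ec.
  apply: HomEq_eq; apply: Over_eq ot; rewrite -c2.
  exact: VOver_comp ow' (uh_over H).
move=> ?; subst w'; rewrite ec; f_equal; exact: proof_irrelevance.
Qed.

(** The map [s^*(m) -> uh_s^*(m)] classifying [h : s^*(m) -> f]. *)
Definition uh_map (E B : Category) (p : Functor E B) (cl : Cleavage p)
  (m f : VOb p) (H : UniversalHom cl m f) (K : B)
  (s : Hom K (vbase m)) (h : VHom (vreindex cl s) f) :
  VHom (vreindex cl s) (vreindex cl (uh_s H)) := the (uh_map_unique H h).

Section StepOneLawfs.
Context (E B : Category) (p : Functor E B) (cl : Cleavage p) (m : VOb p).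
Context (S : StepOne cl m).

Local Notation "b • a" := (@comp (V p) _ _ _ b a) (at level 40, left associativity).

Lemma uh_map_lift (f : VOb p) (H : UniversalHom cl m f) (K : B)
  (s : Hom K (vbase m)) (h : VHom (vreindex cl s) f) :
  vlift cl (uh_s H) • uh_map H h = vlift cl s.
Proof. exact: (proj1 (the_spec (uh_map_unique H h))). Qed.

Lemma uh_map_h (f : VOb p) (H : UniversalHom cl m f) (K : B)
  (s : Hom K (vbase m)) (h : VHom (vreindex cl s) f) :
  uh_h H • uh_map H h = h.
Proof. exact: (proj2 (the_spec (uh_map_unique H h))). Qed.

Lemma uh_map_eq (f : VOb p) (H : UniversalHom cl m f) (K : B)
  (s : Hom K (vbase m)) (c c' : VHom (vreindex cl s) (vreindex cl (uh_s H))) :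
  vlift cl (uh_s H) • c = vlift cl s -> vlift cl (uh_s H) • c' = vlift cl s ->
  uh_h H • c = uh_h H • c' -> c = c'.
Proof. by move=> *; apply: (exists_unique_eq (uh_map_unique H (uh_h H • c'))). Qed.

Lemma so_ext (f g : VOb p) (a b : VHom (so_Lob S f) g) :
  vh_dom a = vh_dom b -> a • so_k S f = b • so_k S f -> a = b.
Proof.
move=> e0 e1.
have h := so_k_opcart S f g (b • so_k S f) (vh_dom b) eq_refl.
exact: (exists_unique_eq h).
Qed.

Lemma so_k_dom (f : VOb p) : vh_dom (so_k S f) = vh_dom (uh_h (so_hom S f)).
Proof.
by have /= := f_equal vh_dom (so_factor S f); rewrite so_eps_dom comp_idl.
Qed.

Definition so_act_map (f g : VOb p) (a : VHom f g) :=
  uh_map (so_hom S g) (a • uh_h (so_hom S f)).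

Lemma so_act_unique (f g : VOb p) (a : VHom f g) :
  exists! b : VHom (so_Lob S f) (so_Lob S g),
    vh_dom b = vh_dom a /\ b • so_k S f = so_k S g • so_act_map a.
Proof.
apply: (so_k_opcart S f (so_Lob S g) (so_k S g • so_act_map a) (vh_dom a)).
have /= e := f_equal vh_dom (uh_map_h (so_hom S g) (a • uh_h (so_hom S f))).
by rewrite /= so_k_dom /so_act_map /= so_k_dom e.
Qed.

Definition so_act (f g : VOb p) (a : VHom f g) : VHom (so_Lob S f) (so_Lob S g) :=
  the (so_act_unique a).

Lemma so_act_dom (f g : VOb p) (a : VHom f g) : vh_dom (so_act a) = vh_dom a.
Proof. exact: (proj1 (the_spec (so_act_unique a))). Qed.

Lemma so_act_k (f g : VOb p) (a : VHom f g) :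
  so_act a • so_k S f = so_k S g • so_act_map a.
Proof. exact: (proj2 (the_spec (so_act_unique a))). Qed.

Lemma so_act_id (f : VOb p) : so_act (@idm (V p) f) = @idm (V p) (so_Lob S f).
Proof.
apply: so_ext; first exact: so_act_dom.
rewrite so_act_k comp_idl -[RHS](@comp_idr (V p)); f_equal.
apply: uh_map_eq; rewrite ?uh_map_lift ?comp_idr //.
by rewrite uh_map_h comp_idl.
Qed.

Lemma so_act_comp (f g h : VOb p) (b : VHom g h) (a : VHom f g) :
  so_act (b • a) = so_act b • so_act a.
Proof.
apply: so_ext; first by rewrite /= !so_act_dom.
rewrite -comp_assoc !so_act_k comp_assoc so_act_k -comp_assoc; f_equal.
apply: uh_map_eq; rewrite ?comp_assoc ?uh_map_lift //.
by rewrite !uh_map_h -!comp_assoc uh_map_h.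
Qed.

Lemma so_eps_nat (f g : VOb p) (a : VHom f g) :
  so_eps S g • so_act a = a • so_eps S f.
Proof.
apply: so_ext; first by rewrite /= so_act_dom !so_eps_dom comp_idl comp_idr.
by rewrite -!comp_assoc so_act_k so_factor comp_assoc so_factor uh_map_h.
Qed.

Definition so_Kfun : Functor (V p) E.
Proof.
unshelve refine {| fob := so_K S : V p -> E;
  fmap := fun f g (a : @Hom (V p) f g) => vh_cod (so_act a) |}.
- by move=> f; rewrite so_act_id.
- by move=> f g h b a; rewrite so_act_comp.
Defined.

Lemma so_R_vert (f : VOb p) : Vertical p (vh_cod (so_eps S f)).
Proof.
exists (vbase f).
have [J oJ] := so_L_vert S f.
have [w ow] : exists w : Hom (vbase f) (vbase f), Over p (vh_cod (so_eps S f)) w.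
  apply: Over_ex; last exact: Vertical_base (vvert f).
  exact: Vertical_base (so_L_vert S f).
have -> : idm (vbase f) = w; last by [].
apply: HomEq_eq; apply: Over_eq (Vertical_over (vvert f) eq_refl) _ _ _ _.
have := vh_comm (so_eps S f); rewrite so_eps_dom comp_idr => ->.
exact: Over_idr (Vertical_over (so_L_vert S f) eq_refl) ow.
Qed.

Definition so_L_nt : NatTrans (dom_functor p) so_Kfun.
Proof.
refine {| nt := fun f : V p => so_L S f : Hom (dom_functor p f) (so_Kfun f) |}.
by move=> f g a; rewrite /= -(so_act_dom a); exact: (vh_comm (so_act a)).
Defined.

Definition so_R_nt : NatTrans so_Kfun (cod_functor p).
Proof.
refine {| nt := fun f : V p => vh_cod (so_eps S f) : Hom (so_Kfun f) (cod_functor p f) |}.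
by move=> f g a; exact: (f_equal vh_cod (so_eps_nat a)).
Defined.

Definition step_one_ff : FunctorialFactorisation p.
Proof.
refine {| ffK := so_Kfun; ffL := so_L_nt; ffR := so_R_nt;
  ffL_vert := so_L_vert S; ffR_vert := so_R_vert |}.
by move=> f; have := vh_comm (so_eps S f); rewrite so_eps_dom comp_idr => ->.
Defined.

Lemma so_fmap_L (f g : VOb p) (a : VHom f g) :
  @fmap _ _ (Lfun step_one_ff) f g a = so_act a.
Proof. by apply: VHom_ext; rewrite ?so_act_dom. Qed.

Lemma so_copoint (f : VOb p) : Lcopoint step_one_ff f = so_eps S f.
Proof. by apply: VHom_ext; rewrite ?so_eps_dom. Qed.

Definition so_Sigma_map (f : VOb p) :=
  uh_map (so_hom S (so_Lob S f)) (so_k S f).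

Lemma so_Sigma_unique (f : VOb p) :
  exists! b : VHom (so_Lob S f) (so_Lob S (so_Lob S f)),
    vh_dom b = idm (vdom f) /\
    b • so_k S f = so_k S (so_Lob S f) • so_Sigma_map f.
Proof.
apply: (so_k_opcart S f (so_Lob S (so_Lob S f)) (so_k S (so_Lob S f) • so_Sigma_map f) (idm (vdom f))).
have /= e := f_equal vh_dom (uh_map_h (so_hom S (so_Lob S f)) (so_k S f)).
by rewrite /= comp_idl (so_k_dom (so_Lob S f)) e.
Qed.

Definition so_Sigma (f : VOb p) : VHom (so_Lob S f) (so_Lob S (so_Lob S f)) :=
  the (so_Sigma_unique f).

Lemma so_Sigma_dom (f : VOb p) : vh_dom (so_Sigma f) = idm (vdom f).
Proof. exact: (proj1 (the_spec (so_Sigma_unique f))). Qed.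

Lemma so_Sigma_k (f : VOb p) :
  so_Sigma f • so_k S f = so_k S (so_Lob S f) • so_Sigma_map f.
Proof. exact: (proj2 (the_spec (so_Sigma_unique f))). Qed.

Lemma so_Sigma_nat (f g : VOb p) (a : VHom f g) :
  so_Sigma g • so_act a = so_act (so_act a) • so_Sigma f.
Proof.
apply: so_ext; first by rewrite /= !so_act_dom !so_Sigma_dom comp_idl comp_idr.
rewrite -!comp_assoc so_act_k so_Sigma_k !comp_assoc so_Sigma_k so_act_k -!comp_assoc.
f_equal; apply: uh_map_eq; rewrite ?comp_assoc ?uh_map_lift //.
by rewrite !uh_map_h -!comp_assoc uh_map_h so_act_k.
Qed.

Definition so_Sigma_nt :
  NatTrans (Lfun step_one_ff) (comp_functor (Lfun step_one_ff) (Lfun step_one_ff)).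
Proof.
refine {| nt := fun f : V p => so_Sigma f
  : @Hom (V p) (Lfun step_one_ff f)
      (comp_functor (Lfun step_one_ff) (Lfun step_one_ff) f) |}.
move=> f g a; have h : fmap (comp_functor (Lfun step_one_ff) (Lfun step_one_ff)) a
    = so_act (so_act a).
  by rewrite -(so_fmap_L (so_act a)) -(so_fmap_L a).
by rewrite h so_fmap_L; exact: so_Sigma_nat.
Defined.

Lemma so_comonad : IsComonad (Lcopoint step_one_ff) so_Sigma_nt.
Proof.
split; last split.
- move=> f; rewrite so_copoint.
  apply: so_ext; first by rewrite /= so_eps_dom so_Sigma_dom comp_idl.
  by rewrite -comp_assoc so_Sigma_k comp_assoc so_factor uh_map_h comp_idl.
- move=> f; rewrite so_copoint so_fmap_L.
  apply: so_ext; first by rewrite /= so_act_dom so_eps_dom so_Sigma_dom comp_idl.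
  rewrite -comp_assoc so_Sigma_k comp_assoc so_act_k comp_idl -comp_assoc.
  rewrite -[RHS](@comp_idr (V p)); f_equal.
  apply: uh_map_eq; rewrite ?comp_idr ?comp_assoc ?uh_map_lift //.
  by rewrite uh_map_h -comp_assoc uh_map_h so_factor.
- move=> f; rewrite so_fmap_L.
  apply: so_ext; first by rewrite /= so_act_dom !so_Sigma_dom.
  rewrite -!comp_assoc so_Sigma_k !comp_assoc so_Sigma_k so_act_k -!comp_assoc.
  f_equal; apply: uh_map_eq; rewrite ?comp_assoc ?uh_map_lift //.
  by rewrite !uh_map_h -!comp_assoc uh_map_h so_Sigma_k.
Qed.

Definition step_one : Lawfs p :=
  {| lw_ff := step_one_ff; lw_Sigma := so_Sigma_nt;
     lw_Sigma_dom := so_Sigma_dom; lw_comonad := so_comonad |}.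

End StepOneLawfs.

Definition IsCofibrantlyGenerated (E B : Category) (p : Functor E B) (cl : Cleavage p)
  (m : VOb p) (S : StepOne cl m) (A : Awfs p) : Prop :=
  IsAlgebraicallyFreeOn A (step_one S).

Section CoproductEndofunctor.
Context (E B : Category) (p : Functor E B) (F : FunctorialFactorisation p).
Context (I : B) (cp : BinaryCoproducts (Fibre p I)) (Y : Fibre p I) (f : Slice Y).

Definition slice_V (g : SliceOb Y) : VOb p :=
  {| vmap := fh_map (sl_map g); vvert := ex_intro _ I (fh_over (sl_map g)) |}.

Definition slice_VHom (g g' : SliceOb Y) (a : SliceHom g g') :
  VHom (slice_V g) (slice_V g').
Proof.
refine (@Build_VHom E B p (slice_V g) (slice_V g') (fh_map (sh_map a)) (idm _) _).
by rewrite comp_idl; exact: (f_equal fh_map (sh_comm a)).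
Defined.

Definition slice_K (g : SliceOb Y) : Fibre p I :=
  {| fib_ob := ffK F (slice_V g);
     fib_eq := eq_trans (Vertical_base (ffL_vert F (slice_V g))) (fib_eq (sl_ob g)) |}.

Definition slice_L (g : SliceOb Y) : @Hom (Fibre p I) (sl_ob g) (slice_K g) :=
  @Build_FibHom E B p I (sl_ob g) (slice_K g) (ffL F (slice_V g))
    (Vertical_over (ffL_vert F (slice_V g)) (fib_eq (sl_ob g))).

Definition slice_R (g : SliceOb Y) : @Hom (Fibre p I) (slice_K g) Y :=
  @Build_FibHom E B p I (slice_K g) Y (ffR F (slice_V g))
    (Vertical_over (ffR_vert F (slice_V g)) (fib_eq (slice_K g))).

Lemma slice_K_over (g g' : SliceOb Y) (a : SliceHom g g') :
  Over p (fmap (ffK F) (slice_VHom a : @Hom (V p) _ _)) (idm I).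
Proof.
have [w ow] := Over_ex (fmap (ffK F) (slice_VHom a : @Hom (V p) (slice_V g) (slice_V g')))
  (fib_eq (slice_K g)) (fib_eq (slice_K g')).
have -> : idm I = w; last by [].
apply: HomEq_eq.
apply: Over_eq (Over_idl (fh_over (sh_map a)) (fh_over (slice_L g'))) _ _ _ _.
rewrite (nt_nat (ffL F) (slice_VHom a : @Hom (V p) (slice_V g) (slice_V g'))).
exact: Over_idr (fh_over (slice_L g)) ow.
Qed.

Definition slice_Kmap (g g' : SliceOb Y) (a : SliceHom g g') :
  @Hom (Fibre p I) (slice_K g) (slice_K g') :=
  @Build_FibHom E B p I (slice_K g) (slice_K g') _ (slice_K_over a).

Lemma slice_Kmap_id (g : SliceOb Y) : slice_Kmap (@idm (Slice Y) g) = idm (slice_K g).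
Proof.
apply: FibHom_ext => /=; rewrite -fmap_id; f_equal; exact: VHom_ext.
Qed.

Lemma slice_Kmap_comp (g g' g'' : SliceOb Y) (b : SliceHom g' g'') (a : SliceHom g g') :
  slice_Kmap (@comp (Slice Y) _ _ _ b a) = slice_Kmap b ∘ slice_Kmap a.
Proof.
apply: FibHom_ext => /=; rewrite -fmap_comp; f_equal.
by apply: VHom_ext => //=; rewrite comp_idl.
Qed.

Lemma slice_Kmap_L (g g' : SliceOb Y) (a : SliceHom g g') :
  slice_L g' ∘ sh_map a = slice_Kmap a ∘ slice_L g.
Proof. apply: FibHom_ext; exact: (nt_nat (ffL F) (slice_VHom a : @Hom (V p) _ _)). Qed.

Lemma slice_Kmap_R (g g' : SliceOb Y) (a : SliceHom g g') :
  slice_R g' ∘ slice_Kmap a = slice_R g.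
Proof.
apply: FibHom_ext.
have /= -> := nt_nat (ffR F) (slice_VHom a : @Hom (V p) (slice_V g) (slice_V g')).
exact: comp_idl.
Qed.

Lemma slice_LR (g : SliceOb Y) : slice_R g ∘ slice_L g = sl_map g.
Proof. apply: FibHom_ext; exact: (ff_factor F (slice_V g)). Qed.

Definition coproduct_ob (g : SliceOb Y) : SliceOb Y :=
  {| sl_ob := cop cp (sl_ob f) (slice_K g);
     sl_map := copair cp (sl_map f) (slice_R g) |}.

Definition coproduct_mor (g g' : SliceOb Y) (a : SliceHom g g') :
  Hom (cop cp (sl_ob f) (slice_K g)) (cop cp (sl_ob f) (slice_K g')) :=
  copair cp (cop_inl cp _ _) (cop_inr cp _ _ ∘ slice_Kmap a).

Lemma coproduct_mor_comm (g g' : SliceOb Y) (a : SliceHom g g') :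
  copair cp (sl_map f) (slice_R g') ∘ coproduct_mor a = copair cp (sl_map f) (slice_R g).
Proof. by rewrite copair_post copair_inl comp_assoc copair_inr slice_Kmap_R. Qed.

Definition coproduct_map (g g' : SliceOb Y) (a : SliceHom g g') :
  SliceHom (coproduct_ob g) (coproduct_ob g') :=
  @Build_SliceHom _ _ (coproduct_ob g) (coproduct_ob g')
    (coproduct_mor a) (coproduct_mor_comm a).

Lemma coproduct_mor_id (g : SliceOb Y) :
  coproduct_mor (@idm (Slice Y) g) = idm (cop cp (sl_ob f) (slice_K g)).
Proof. by rewrite /coproduct_mor slice_Kmap_id comp_idr copair_id. Qed.

Lemma coproduct_mor_comp (g g' g'' : SliceOb Y) (b : SliceHom g' g'') (a : SliceHom g g') :
  coproduct_mor (@comp (Slice Y) _ _ _ b a) = coproduct_mor b ∘ coproduct_mor a.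
Proof.
rewrite {2 3}/coproduct_mor copair_post copair_inl comp_assoc copair_inr -comp_assoc.
by rewrite -slice_Kmap_comp.
Qed.

Definition coproduct_endofunctor : Functor (Slice Y) (Slice Y).
Proof.
unshelve refine {| fob := coproduct_ob : Slice Y -> Slice Y;
  fmap := coproduct_map : forall g g' : Slice Y, Hom g g' -> _ |}.
- by move=> g; apply: SliceHom_ext; exact: coproduct_mor_id.
- by move=> g g' g'' b a; apply: SliceHom_ext; exact: coproduct_mor_comp.
Defined.

Definition coproduct_point_map (g : SliceOb Y) : SliceHom g (coproduct_ob g).
Proof.
refine (@Build_SliceHom _ _ g (coproduct_ob g) (cop_inr cp _ _ ∘ slice_L g) _).
change (copair cp (sl_map f) (slice_R g) ∘ (cop_inr cp _ _ ∘ slice_L g) = sl_map g).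
by rewrite comp_assoc copair_inr slice_LR.
Defined.

Definition coproduct_point : NatTrans (id_functor (Slice Y)) coproduct_endofunctor.
Proof.
refine {| nt := coproduct_point_map
  : forall g : Slice Y, Hom (id_functor (Slice Y) g) (coproduct_endofunctor g) |}.
move=> g g' a; apply: SliceHom_ext.
change (cop_inr cp _ _ ∘ slice_L g' ∘ sh_map a
  = coproduct_mor a ∘ (cop_inr cp _ _ ∘ slice_L g)).
by rewrite /coproduct_mor -comp_assoc slice_Kmap_L !comp_assoc copair_inr.
Defined.

End CoproductEndofunctor.

Definition base_ob (E B : Category) (p : Functor E B) (Y : E) : Fibre p (p Y) :=
  {| fib_ob := Y; fib_eq := eq_refl |}.

Definition vertical_slice (E B : Category) (p : Functor E B) (X Y : E) (f : Hom X Y)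
  (Hf : Vertical p f) : Slice (base_ob p Y) :=
  let eX := eq_sym (Vertical_base Hf) in
  {| sl_ob := {| fib_ob := X; fib_eq := eX |} : Fibre p (p Y);
     sl_map := @Build_FibHom E B p (p Y) {| fib_ob := X; fib_eq := eX |} (base_ob p Y)
                 f (Vertical_over Hf eX) |}.

(* Main.v *)
(** The argument works for any lawfs [(L, R)]. The comultiplication makes algebras
    for the pointed endofunctor [R] compose: if [g] and [h] are algebras then so is
    [h ∘ g], functorially in squares, associatively and unitally. An algebra for the
    pointed endofunctor [g |-> <f, R g>] on the slice over [Y] is an [R]-algebra over
    [Y] under [f]; since algebra structures pull back along maps between codomains,
    an initial one is a free [R]-algebra on [f] with respect to all squares out of
    [f]. The free algebras [R' f] form a monad over [cod] with unit [L' f]. The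
    comultiplication [L' => L' L'] at [f] extends [L' L' f] to the free algebra [R' f]
    along the composite algebra [R' f ∘ R' (L' f)]. All the laws, including
    distributivity, then compare algebra morphisms out of a free algebra that agree
    on its unit; coassociativity is where associativity of the composition enters. *)
From Corelib Require Import ssreflect.
From Stdlib Require Import ProofIrrelevance FunctionalExtensionality ClassicalEpsilon.
Require Import Defs.

Set Implicit Arguments.
Unset Strict Implicit.
Unset Printing Implicit Defensive.

Local Open Scope cat_scope.

(** * Vertical maps and equality of functors *)

Lemma Vertical_idm (E B : Category) (p : Functor E B) (X : E) : Vertical p (idm X).
Proof. by exists (p X); exact: Over_id. Qed.

Lemma Vertical_comp (E B : Category) (p : Functor E B) (X Y Z : E)
  (f : Hom X Y) (g : Hom Y Z) : Vertical p f -> Vertical p g -> Vertical p (g ∘ f).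
Proof.
move=> vf vg; exists (p X).
exact: Over_idl (Vertical_over vf eq_refl) (Vertical_over vg (Vertical_base vf)).
Qed.

(** As [f] lies over an identity, [g] and [g ∘ f] lie over the same base map. *)
Lemma Vertical_cancel (E B : Category) (p : Functor E B) (X Y Z : E)
  (f : Hom X Y) (g : Hom Y Z) : Vertical p f -> Vertical p (g ∘ f) -> Vertical p g.
Proof.
move=> vf vgf; exists (p X).
have [w ow] := Over_ex g (Vertical_base vf) (Vertical_base vgf).
have -> : idm (p X) = w; last by [].
apply: HomEq_eq; apply: Over_eq (Vertical_over vgf eq_refl) _ _ _ _.
exact: Over_idr (Vertical_over vf eq_refl) ow.
Qed.

(** Morphisms are compared by [HomEq] because their end points agree only propositionally; once the
    object parts are identified this is plain equality. *)
Lemma functor_ext (C D : Category) (F G : Functor C D) :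
  (forall X, F X = G X) ->
  (forall (X Y : C) (f : Hom X Y), HomEq (fmap F f) (fmap G f)) -> F = G.
Proof.
case: F G => F0 F1 Fi Fc [G0 G1 Gi Gc] /= e h.
have e0 : F0 = G0 by exact: functional_extensionality.
subst G0.
have e1 : F1 = G1.
  do 3 (apply: functional_extensionality_dep => ?).
  exact: HomEq_eq.
subst G1; f_equal; exact: proof_irrelevance.
Qed.

(** * Equality of algebra morphisms with propositionally equal structures *)

Section AlgebraEquality.
Context (C : Category) (T : Functor C C) (eta : NatTrans (id_functor C) T)
  (mu : NatTrans (comp_functor T T) T).

(** The algebras are displayed by their constructors so that the equations between structure maps
    can be substituted. *)
Lemma PAlg_HomEq (X Y : C) (s s' : Hom (T X) X) (t t' : Hom (T Y) Y) hs hs' ht ht'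
  (a : @Hom (PAlg eta) (@Build_PAlgOb C T eta X s hs) (@Build_PAlgOb C T eta Y t ht))
  (b : @Hom (PAlg eta) (@Build_PAlgOb C T eta X s' hs') (@Build_PAlgOb C T eta Y t' ht')) :
  s = s' -> t = t' -> ph_map a = ph_map b -> HomEq a b.
Proof.
move=> es et; subst s' t'.
move: a b; rewrite (proof_irrelevance _ hs' hs) (proof_irrelevance _ ht' ht) => a b e.
by rewrite (PAlgHom_ext e : a = b).
Qed.

Lemma MAlg_HomEq (X Y : C) (s s' : Hom (T X) X) (t t' : Hom (T Y) Y) hs hs' ht ht'
  as_ as' at_ at'
  (a : @Hom (MAlg eta mu) (@Build_MAlgOb C T eta mu (@Build_PAlgOb C T eta X s hs) as_)
    (@Build_MAlgOb C T eta mu (@Build_PAlgOb C T eta Y t ht) at_))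
  (b : @Hom (MAlg eta mu) (@Build_MAlgOb C T eta mu (@Build_PAlgOb C T eta X s' hs') as')
    (@Build_MAlgOb C T eta mu (@Build_PAlgOb C T eta Y t' ht') at')) :
  s = s' -> t = t' -> ph_map a = ph_map b -> HomEq a b.
Proof.
move=> es et; subst s' t'; rewrite (proof_irrelevance _ hs' hs) (proof_irrelevance _ ht' ht)
  in as' at' b *; rewrite (proof_irrelevance _ as' as_) (proof_irrelevance _ at' at_) in b *.
by move=> e; rewrite (PAlgHom_ext e : a = b).
Qed.

End AlgebraEquality.

(** * A criterion for the induced functor on algebras to be an isomorphism *)

Section InducedIso.
Context (C : Category) (T T' : Functor C C) (eta : NatTrans (id_functor C) T)
  (eta' : NatTrans (id_functor C) T') (mu' : NatTrans (comp_functor T' T') T').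
Context (r : NatTrans T T') (Hr : forall A, r A ∘ eta A = eta' A).
Context (em : forall A : PAlg eta, Hom (T' (pa_ob A)) (pa_ob A)).
Context (em_unit : forall A : PAlg eta, em A ∘ eta' (pa_ob A) = idm (pa_ob A)).
Context (em_assoc : forall A : PAlg eta, em A ∘ mu' (pa_ob A) = em A ∘ fmap T' (em A)).
Context (em_nat : forall (A A' : PAlg eta) (t : PAlgHom A A'),
  ph_map t ∘ em A = em A' ∘ fmap T' (ph_map t)).

Local Notation G := (comp_functor (PAlg_induced Hr) (MAlg_forget eta' mu')).

Definition em_ob (A : PAlg eta) : MAlg eta' mu' :=
  @Build_MAlgOb C T' eta' mu' (@Build_PAlgOb C T' eta' (pa_ob A) (em A) (em_unit A))
    (em_assoc A).

Definition em_hom (A A' : PAlg eta) (t : Hom A A') : Hom (em_ob A) (em_ob A') :=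
  @Build_PAlgHom C T' eta' (ma_palg (em_ob A)) (ma_palg (em_ob A')) (ph_map t) (em_nat t).

Definition em_functor : Functor (PAlg eta) (MAlg eta' mu').
Proof. by refine {| fob := em_ob; fmap := em_hom |}; move=> *; apply: PAlgHom_ext. Defined.

(** The inverse is [em_functor]. The hypotheses say that both round trips preserve structure maps,
    and neither functor changes an underlying object or map. *)
Lemma induced_iso :
  (forall A : PAlg eta, em A ∘ r (pa_ob A) = pa_str A) ->
  (forall M : MAlg eta' mu', em (G M) = pa_str (ma_palg M)) ->
  IsIsoOfCategories G.
Proof.
move=> e e'.
have h1 (M M' : MAlg eta' mu') (t : Hom M M') : HomEq (fmap (comp_functor em_functor G) t) t.
  have := e' M; have := e' M'.
  case: M M' t => [[X s hs] hM] [[Y s' hs'] hM'] t es' es.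
  exact: MAlg_HomEq.
have h2 (A A' : PAlg eta) (t : Hom A A') : HomEq (fmap (comp_functor G em_functor) t) t.
  have := e A; have := e A'.
  case: A A' t => [X s hs] [Y s' hs'] t es' es.
  exact: PAlg_HomEq.
exists em_functor; split; apply: functor_ext.
(* The equation on objects is read off from the end point of the [HomEq] on an identity. *)
- move=> M; exact: (HomEq_dom (h1 M M (idm M))).
- exact: h1.
- move=> A; exact: (HomEq_dom (h2 A A (idm A))).
- exact: h2.
Qed.

End InducedIso.

(** * Algebras for the pointed endofunctor, and free algebras *)

Section AlgebraStructures.
Context (E B : Category) (p : Functor E B) (F : FunctorialFactorisation p).
Local Notation "b • a" := (@comp (V p) _ _ _ b a) (at level 40, left associativity).

(** This is the domain component of an algebra for the pointed endofunctor [R]; the unit law forces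
    the codomain component to be an identity, and [as_R] is the remaining square. *)
Record AlgStr (g : VOb p) := {
  as_map :> Hom (ffK F g) (vdom g);
  as_L : as_map ∘ ffL F g = idm (vdom g);
  as_R : vmap g ∘ as_map = ffR F g }.

Definition IsAlgHom (g g' : VOb p) (a : AlgStr g) (a' : AlgStr g') (t : VHom g g') :
  Prop := vh_dom t ∘ a = a' ∘ fmap (ffK F) (t : @Hom (V p) g g').

Lemma IsAlgHom_id (g : VOb p) (a : AlgStr g) : IsAlgHom a a (@idm (V p) g).
Proof. by rewrite /IsAlgHom fmap_id comp_idl comp_idr. Qed.

Lemma IsAlgHom_comp (g g' g'' : VOb p) (a : AlgStr g) (a' : AlgStr g') (a'' : AlgStr g'')
  (t : VHom g g') (u : VHom g' g'') :
  IsAlgHom a a' t -> IsAlgHom a' a'' u -> IsAlgHom a a'' (u • t).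
Proof.
rewrite /IsAlgHom => ht hu.
by rewrite fmap_comp /= -comp_assoc ht comp_assoc hu comp_assoc.
Qed.

(** The universal property is tested on squares from [f] into algebras over an
    arbitrary codomain, not only over that of [f]. *)
Record FreeAlgebra (f : VOb p) := {
  fa_K : E;
  fa_L : Hom (vdom f) fa_K;
  fa_L_vert : Vertical p fa_L;
  fa_R : Hom fa_K (vcod f);
  fa_R_vert : Vertical p fa_R;
  fa_factor : fa_R ∘ fa_L = vmap f;
  fa_ob := {| vmap := fa_R; vvert := fa_R_vert |};
  fa_unit := @Build_VHom E B p f fa_ob fa_L (idm (vcod f))
    (eq_trans fa_factor (eq_sym (comp_idl (vmap f))));
  fa_str : AlgStr fa_ob;
  fa_univ : forall (g : VOb p) (a : AlgStr g) (h : VHom f g),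
    exists! t : VHom fa_ob g, IsAlgHom fa_str a t /\ t • fa_unit = h }.

End AlgebraStructures.

(** * Composition of algebras over a lawfs *)

Section AlgebraComposition.
Context (E B : Category) (p : Functor E B) (F : Lawfs p).
Local Notation "b • a" := (@comp (V p) _ _ _ b a) (at level 40, left associativity).
Local Notation K := (ffK F).

Definition comult (f : VOb p) : Hom (K f) (K (Lob F f)) := vh_cod (lw_Sigma F f).

Definition mkV (X Y : E) (g : Hom X Y) (vg : Vertical p g) : VOb p :=
  {| vmap := g; vvert := vg |}.

Definition vcomp (X Y Z : E) (g : Hom X Y) (vg : Vertical p g) (h : Hom Y Z)
  (vh : Vertical p h) : VOb p := mkV (Vertical_comp vg vh).

Lemma comult_L (f : VOb p) : comult f ∘ ffL F f = ffL F (Lob F f).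
Proof. by have /= <- := vh_comm (lw_Sigma F f); rewrite lw_Sigma_dom comp_idr. Qed.

Lemma comult_counit (f : VOb p) : ffR F (Lob F f) ∘ comult f = idm _.
Proof. exact: (f_equal vh_cod (proj1 (lw_comonad F) f)). Qed.

Lemma comult_counit_fmap (f : VOb p) : fmap K (Lcopoint F f) ∘ comult f = idm _.
Proof. exact: (f_equal vh_cod (proj1 (proj2 (lw_comonad F)) f)). Qed.

Lemma comult_coassoc (f : VOb p) :
  comult (Lob F f) ∘ comult f = fmap K (lw_Sigma F f) ∘ comult f.
Proof. exact: (f_equal vh_cod (proj2 (proj2 (lw_comonad F)) f)). Qed.

Lemma comult_nat (f g : VOb p) (a : @Hom (V p) f g) :
  comult g ∘ fmap K a = fmap K (fmap (Lfun F) a) ∘ comult f.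
Proof. exact: (f_equal vh_cod (nt_nat (lw_Sigma F) a)). Qed.

Section Composite.
Context (X Y Z : E) (g : Hom X Y) (vg : Vertical p g) (h : Hom Y Z) (vh : Vertical p h).
Context (a : AlgStr F (mkV vg)) (b : AlgStr F (mkV vh)).

Definition vcomp_snd : VHom (vcomp vg vh) (mkV vh) :=
  @Build_VHom E B p (vcomp vg vh) (mkV vh) g (idm Z) (eq_sym (comp_idl (h ∘ g))).

Lemma comp_square_comm :
  g ∘ idm X = b ∘ fmap K (vcomp_snd : @Hom (V p) _ _) ∘ ffL F (vcomp vg vh).
Proof.
have /= e := nt_nat (ffL F) (vcomp_snd : @Hom (V p) _ _).
by rewrite -comp_assoc -e comp_assoc (as_L b) comp_idl comp_idr.
Qed.

Definition comp_square : VHom (Lob F (vcomp vg vh)) (mkV vg) :=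
  @Build_VHom E B p (Lob F (vcomp vg vh)) (mkV vg) (idm X) _ comp_square_comm.

(** With [a] and [b] filling squares against [g] and [h], the composite fills a
    square against [h ∘ g] with [b] first and then with [a]; [comp_square] is the
    square left for [a]. *)
Definition comp_str_map : Hom (K (vcomp vg vh)) X :=
  a ∘ fmap K (comp_square : @Hom (V p) _ _) ∘ comult (vcomp vg vh).

(** Composing [a] with [g] gives [R]; naturality of [R] then exposes the codomain component of
    [comp_square], and a counit law removes [comult]. *)
Lemma comp_str_fst : g ∘ comp_str_map = b ∘ fmap K (vcomp_snd : @Hom (V p) _ _).
Proof.
rewrite /comp_str_map !comp_assoc (as_R a : g ∘ a = _).
have /= -> := nt_nat (ffR F) (comp_square : @Hom (V p) _ _).
by rewrite -comp_assoc comult_counit comp_idr.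
Qed.

Definition comp_str : AlgStr F (vcomp vg vh).
Proof.
refine (@Build_AlgStr E B p F (vcomp vg vh) comp_str_map _ _).
- rewrite /comp_str_map -!comp_assoc comult_L.
  have /= <- := nt_nat (ffL F) (comp_square : @Hom (V p) _ _).
  by rewrite comp_assoc (as_L a) comp_idl.
- rewrite /= -comp_assoc comp_str_fst comp_assoc (as_R b : h ∘ b = _).
  by have /= -> := nt_nat (ffR F) (vcomp_snd : @Hom (V p) _ _); rewrite comp_idl.
Defined.

Lemma vcomp_snd_alg : IsAlgHom comp_str b vcomp_snd.
Proof. exact: comp_str_fst. Qed.

End Composite.

Section Stack.
Context (X Y Z : E) (g : Hom X Y) (vg : Vertical p g) (h : Hom Y Z) (vh : Vertical p h).
Context (X' Y' Z' : E) (g' : Hom X' Y') (vg' : Vertical p g')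
  (h' : Hom Y' Z') (vh' : Vertical p h').
Context (t : VHom (mkV vg) (mkV vg')) (u : VHom (mkV vh) (mkV vh'))
  (e : vh_cod t = vh_dom u).

Definition stack : VHom (vcomp vg vh) (vcomp vg' vh').
Proof.
refine (@Build_VHom E B p (vcomp vg vh) (vcomp vg' vh') (vh_dom t) (vh_cod u) _).
have /= et := vh_comm t; have /= eu := vh_comm u.
by rewrite /= -comp_assoc et e comp_assoc eu comp_assoc.
Defined.

(** This makes composition of algebras functorial in squares. First [t] moves past [a]; naturality
    of [comult] leaves an equality of squares, in which [u] moves past [b]. *)
Lemma stack_alg (a : AlgStr F (mkV vg)) (b : AlgStr F (mkV vh))
  (a' : AlgStr F (mkV vg')) (b' : AlgStr F (mkV vh')) :
  IsAlgHom a a' t -> IsAlgHom b b' u -> IsAlgHom (comp_str a b) (comp_str a' b') stack.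
Proof.
rewrite /IsAlgHom /= => ht hu; rewrite /comp_str_map.
rewrite !comp_assoc ht -!comp_assoc comult_nat; f_equal; rewrite !comp_assoc; f_equal.
rewrite -!fmap_comp; f_equal; apply: VHom_ext => /=; first by rewrite comp_idl comp_idr.
rewrite e comp_assoc hu -!comp_assoc; f_equal; rewrite -!fmap_comp; f_equal.
apply: VHom_ext => /=; last by rewrite comp_idl comp_idr.
by have /= := vh_comm t; rewrite e.
Qed.

End Stack.

Definition id_str (Y : E) : AlgStr F (mkV (Vertical_idm p Y)).
Proof.
refine (@Build_AlgStr E B p F (mkV (Vertical_idm p Y)) (ffR F _) _ _).
- exact: ff_factor.
- exact: comp_idl.
Defined.

Definition to_id (g : VOb p) : VHom g (mkV (Vertical_idm p (vcod g))) :=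
  @Build_VHom E B p g (mkV (Vertical_idm p (vcod g))) (vmap g) (idm _) eq_refl.

Lemma to_id_alg (g : VOb p) (a : AlgStr F g) : IsAlgHom a (id_str (vcod g)) (to_id g).
Proof.
rewrite /IsAlgHom /= (as_R a).
by have /= -> := nt_nat (ffR F) (to_id g : @Hom (V p) _ _); rewrite comp_idl.
Qed.

Section Unit.
Context (X Y : E) (g : Hom X Y) (vg : Vertical p g).

Definition vcomp_idl : VHom (vcomp vg (Vertical_idm p Y)) (mkV vg).
Proof.
refine (@Build_VHom E B p (vcomp vg (Vertical_idm p Y)) (mkV vg) (idm X) (idm Y) _).
by rewrite /= comp_idr !comp_idl.
Defined.

(** When the second factor is an identity, [comp_square] is the counit of [L] followed by
    [vcomp_idl], so [comult_counit_fmap] applies. *)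
Lemma vcomp_idl_alg (a : AlgStr F (mkV vg)) :
  IsAlgHom (comp_str a (id_str Y)) a vcomp_idl.
Proof.
rewrite /IsAlgHom /= comp_idl /comp_str_map.
rewrite -[RHS]comp_idr -comult_counit_fmap !comp_assoc; f_equal.
rewrite -!comp_assoc; f_equal; rewrite -fmap_comp; f_equal.
apply: VHom_ext => /=; first by rewrite comp_idl.
have /= -> := nt_nat (ffR F) (vcomp_snd vg (Vertical_idm p Y) : @Hom (V p) _ _).
by [].
Qed.

End Unit.

Section Associativity.
Context (W X Y Z : E) (f : Hom W X) (vf : Vertical p f) (g : Hom X Y)
  (vg : Vertical p g) (h : Hom Y Z) (vh : Vertical p h).

Definition vcomp_assoc :
  VHom (vcomp (Vertical_comp vf vg) vh) (vcomp vf (Vertical_comp vg vh)).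
Proof.
refine (@Build_VHom E B p (vcomp (Vertical_comp vf vg) vh)
  (vcomp vf (Vertical_comp vg vh)) (idm W) (idm Z) _).
by rewrite /= comp_idr comp_idl comp_assoc.
Defined.

(** Naturality brings together the two comultiplications of the left-nested composite, and
    [comult_coassoc] turns one of them into [K] of the comultiplication square. Both sides are then
    [a] after [K] of a square after [comult]. *)
Lemma vcomp_assoc_alg (a : AlgStr F (mkV vf)) (b : AlgStr F (mkV vg))
  (c : AlgStr F (mkV vh)) :
  IsAlgHom (comp_str (comp_str a b) c) (comp_str a (comp_str b c)) vcomp_assoc.
Proof.
rewrite /IsAlgHom /= comp_idl {1}/comp_str_map /= {1}/comp_str_map.
rewrite /comp_str_map -!comp_assoc; f_equal.
rewrite (comult_nat vcomp_assoc) (comp_assoc (comult _)) comult_nat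
  -(comp_assoc _ (comult _)) comult_coassoc.
rewrite !comp_assoc; f_equal.
rewrite -!fmap_comp; f_equal; apply: VHom_ext => /=.
  by rewrite lw_Sigma_dom !comp_idl.
rewrite -!/(comult _) -!comp_assoc; f_equal.
(* In the codomain components [b] has been cancelled; naturality of [comult] again reduces the rest
   to a comparison of squares. *)
rewrite (comp_assoc (comult _)) comult_nat -(comp_assoc _ (comult _)) comult_nat.
rewrite !comp_assoc; f_equal.
rewrite -!fmap_comp; f_equal; apply: VHom_ext => /=; first by rewrite !comp_idl !comp_idr.
rewrite comp_idl -!comp_assoc; f_equal; rewrite -!fmap_comp; f_equal.
by apply: VHom_ext => /=; rewrite ?comp_idl ?comp_idr.
Qed.

End Associativity.
End AlgebraComposition.

(** * The functorial factorisation given by free algebras *)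

Section FreeAwfs.
Context (E B : Category) (p : Functor E B) (F : Lawfs p).
Context (Phi : forall f : VOb p, FreeAlgebra F f).
Local Notation "b • a" := (@comp (V p) _ _ _ b a) (at level 40, left associativity).

Definition free_Rob (f : VOb p) : VOb p := mkV (fa_R_vert (Phi f)).
Definition free_Lob (f : VOb p) : VOb p := mkV (fa_L_vert (Phi f)).
Definition free_str (f : VOb p) : AlgStr F (free_Rob f) := fa_str (Phi f).
Definition free_unit (f : VOb p) : VHom f (free_Rob f) := fa_unit (Phi f).

Definition free_ext (f g : VOb p) (a : AlgStr F g) (h : VHom f g) : VHom (free_Rob f) g :=
  the (fa_univ (Phi f) a h).

Lemma free_ext_alg (f g : VOb p) (a : AlgStr F g) (h : VHom f g) :
  IsAlgHom (free_str f) a (free_ext a h).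
Proof. exact: (proj1 (the_spec (fa_univ (Phi f) a h))). Qed.

Lemma free_ext_eta (f g : VOb p) (a : AlgStr F g) (h : VHom f g) :
  free_ext a h • free_unit f = h.
Proof. exact: (proj2 (the_spec (fa_univ (Phi f) a h))). Qed.

Lemma free_ext_L (f g : VOb p) (a : AlgStr F g) (h : VHom f g) :
  vh_dom (free_ext a h) ∘ fa_L (Phi f) = vh_dom h.
Proof. exact: (f_equal vh_dom (free_ext_eta a h)). Qed.

Lemma free_ext_cod (f g : VOb p) (a : AlgStr F g) (h : VHom f g) :
  vh_cod (free_ext a h) = vh_cod h.
Proof. by rewrite -[LHS]comp_idr; exact: (f_equal vh_cod (free_ext_eta a h)). Qed.

(** Uniqueness in [fa_univ], split into components; the unit is an identity on codomains, so those
    are compared directly. *)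
Lemma free_eq (f g : VOb p) (a : AlgStr F g) (t u : VHom (free_Rob f) g) :
  IsAlgHom (free_str f) a t -> IsAlgHom (free_str f) a u ->
  vh_dom t ∘ fa_L (Phi f) = vh_dom u ∘ fa_L (Phi f) -> vh_cod t = vh_cod u -> t = u.
Proof.
move=> at_ au e e'.
have eu : t • free_unit f = u • free_unit f by apply: VHom_ext => //=; rewrite e'.
exact: (exists_unique_eq (fa_univ (Phi f) a (u • free_unit f))).
Qed.

Definition free_Rmap (f g : VOb p) (t : VHom f g) : VHom (free_Rob f) (free_Rob g) :=
  free_ext (free_str g) (free_unit g • t).

Lemma free_Rmap_alg (f g : VOb p) (t : VHom f g) :
  IsAlgHom (free_str f) (free_str g) (free_Rmap t).
Proof. exact: free_ext_alg. Qed.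

Lemma free_Rmap_cod (f g : VOb p) (t : VHom f g) : vh_cod (free_Rmap t) = vh_cod t.
Proof. by rewrite free_ext_cod; exact: comp_idl. Qed.

Lemma free_Rmap_L (f g : VOb p) (t : VHom f g) :
  vh_dom (free_Rmap t) ∘ fa_L (Phi f) = fa_L (Phi g) ∘ vh_dom t.
Proof. exact: free_ext_L. Qed.

Lemma free_Rmap_id (f : VOb p) : free_Rmap (@idm (V p) f) = @idm (V p) (free_Rob f).
Proof.
apply: (free_eq (free_Rmap_alg _) (IsAlgHom_id _)); last by rewrite free_Rmap_cod.
by rewrite free_Rmap_L comp_idl comp_idr.
Qed.

Lemma free_Rmap_comp (f g h : VOb p) (u : VHom g h) (t : VHom f g) :
  free_Rmap (u • t) = free_Rmap u • free_Rmap t.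
Proof.
apply: (free_eq (free_Rmap_alg _) (IsAlgHom_comp (free_Rmap_alg _) (free_Rmap_alg _))).
- by rewrite free_Rmap_L /= -comp_assoc (free_Rmap_L t) !comp_assoc (free_Rmap_L u).
- by rewrite /= !free_Rmap_cod.
Qed.

Definition free_K : Functor (V p) E.
Proof.
unshelve refine {| fob := fun f : V p => fa_K (Phi f);
  fmap := fun f g (t : @Hom (V p) f g) => vh_dom (free_Rmap t) |}.
- by move=> f; rewrite free_Rmap_id.
- by move=> f g h u t; rewrite free_Rmap_comp.
Defined.

Definition free_L : NatTrans (dom_functor p) free_K.
Proof.
refine {| nt := fun f : V p => fa_L (Phi f) : Hom (dom_functor p f) (free_K f) |}.
by move=> f g t; rewrite /= free_Rmap_L.
Defined.

Definition free_R : NatTrans free_K (cod_functor p).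
Proof.
refine {| nt := fun f : V p => fa_R (Phi f) : Hom (free_K f) (cod_functor p f) |}.
by move=> f g t; rewrite /= -(free_Rmap_cod t); exact: (vh_comm (free_Rmap t)).
Defined.

Definition free_ff : FunctorialFactorisation p :=
  {| ffK := free_K; ffL := free_L; ffR := free_R;
     ffL_vert := fun f => fa_L_vert (Phi f); ffR_vert := fun f => fa_R_vert (Phi f);
     ff_factor := fun f => fa_factor (Phi f) |}.

(** The functor [R'] of the factorisation acts by extension from free algebras, so its values are
    algebra morphisms. *)
Lemma free_Rmap_eq (f g : VOb p) (t : VHom f g) : @fmap _ _ (Rfun free_ff) f g t = free_Rmap t.
Proof. by apply: VHom_ext => //=; rewrite free_Rmap_cod. Qed.

(** * The comultiplication and the comonad laws *)

Definition Lmap (f g : VOb p) (t : VHom f g) : VHom (free_Lob f) (free_Lob g) :=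
  @fmap _ _ (Lfun free_ff) f g t.

Definition RL (f : VOb p) : VOb p := vcomp (fa_R_vert (Phi (free_Lob f))) (fa_R_vert (Phi f)).
Definition RL_str (f : VOb p) : AlgStr F (RL f) := comp_str (free_str (free_Lob f)) (free_str f).

Definition LL (f : VOb p) : VHom f (RL f).
Proof.
refine (@Build_VHom E B p f (RL f) (fa_L (Phi (free_Lob f))) (idm _) _).
by rewrite /= -comp_assoc (fa_factor (Phi (free_Lob f))) comp_idl; exact: fa_factor.
Defined.

Definition comult_ext (f : VOb p) : VHom (free_Rob f) (RL f) := free_ext (RL_str f) (LL f).
Definition free_comult (f : VOb p) : Hom (fa_K (Phi f)) (fa_K (Phi (free_Lob f))) :=
  vh_dom (comult_ext f).

Lemma free_comult_L (f : VOb p) : free_comult f ∘ fa_L (Phi f) = fa_L (Phi (free_Lob f)).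
Proof. exact: (free_ext_L (RL_str f) (LL f)). Qed.

Lemma comult_ext_cod (f : VOb p) : vh_cod (comult_ext f) = idm _.
Proof. exact: free_ext_cod. Qed.

Lemma comult_ext_alg (f : VOb p) : IsAlgHom (free_str f) (RL_str f) (comult_ext f).
Proof. exact: free_ext_alg. Qed.

(** Followed by the projection of the composite algebra to its second factor, [comult_ext f] is an
    algebra endomorphism of [free_str f] fixing the unit. *)
Lemma free_comult_counit (f : VOb p) : fa_R (Phi (free_Lob f)) ∘ free_comult f = idm _.
Proof.
have h := IsAlgHom_comp (comult_ext_alg f) (vcomp_snd_alg (free_str (free_Lob f)) (free_str f)).
apply: (f_equal vh_dom (free_eq h (IsAlgHom_id _) _ _)).
- rewrite /= comp_idl -comp_assoc -/(free_comult f) free_comult_L.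
  exact: (fa_factor (Phi (free_Lob f))).
- by rewrite /= comult_ext_cod comp_idl.
Qed.

Definition Sigma (f : VOb p) : VHom (free_Lob f) (free_Lob (free_Lob f)).
Proof.
refine (@Build_VHom E B p (free_Lob f) (free_Lob (free_Lob f)) (idm _) (free_comult f) _).
by rewrite comp_idr; exact: (eq_sym (free_comult_L f)).
Defined.

Lemma free_comult_nat (f g : VOb p) (t : VHom f g) :
  free_comult g ∘ vh_dom (free_Rmap t) = vh_dom (free_Rmap (Lmap t)) ∘ free_comult f.
Proof.
have e : vh_cod (free_Rmap (Lmap t)) = vh_dom (free_Rmap t) by exact: free_Rmap_cod.
have h1 := IsAlgHom_comp (free_Rmap_alg t) (comult_ext_alg g).
have h2 := IsAlgHom_comp (comult_ext_alg f) 
  (stack_alg e (free_Rmap_alg (Lmap t)) (free_Rmap_alg t)).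
apply: (f_equal vh_dom (free_eq h1 h2 _ _)).
- rewrite /= -!/(free_comult _) -!comp_assoc free_comult_L !free_Rmap_L comp_assoc free_comult_L.
  exact: (eq_sym (free_Rmap_L (Lmap t))).
- by rewrite /= !comult_ext_cod comp_idl comp_idr.
Qed.

Definition free_Sigma :
  NatTrans (Lfun free_ff) (comp_functor (Lfun free_ff) (Lfun free_ff)).
Proof.
refine {| nt := fun f : V p => Sigma f
  : @Hom (V p) (Lfun free_ff f) (comp_functor (Lfun free_ff) (Lfun free_ff) f) |}.
move=> f g t; apply: VHom_ext => /=; first by rewrite comp_idl comp_idr.
exact: free_comult_nat.
Defined.

(** Stack [R'] of the counit with the square from [R' f] to an identity, and remove that identity by
    [vcomp_idl]: the result is an algebra endomorphism fixing the unit. *)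
Lemma free_comult_counit_fmap (f : VOb p) :
  vh_dom (free_Rmap (Lcopoint free_ff f)) ∘ free_comult f = idm _.
Proof.
set c := Lcopoint free_ff f.
have e : vh_cod (free_Rmap c) = vh_dom (to_id (free_Rob f)) by exact: free_Rmap_cod.
have h := IsAlgHom_comp (IsAlgHom_comp (comult_ext_alg f)
  (stack_alg e (free_Rmap_alg c) (to_id_alg (free_str f)))) (vcomp_idl_alg (free_str f)).
(* The inserted identity is the domain component of [vcomp_idl]. *)
rewrite -[LHS](comp_idl).
apply: (f_equal vh_dom (free_eq h (IsAlgHom_id _) _ _)).
- rewrite /= !comp_idl -comp_assoc -/(free_comult f) free_comult_L (free_Rmap_L c).
  exact: comp_idr.
- by rewrite /= comult_ext_cod !comp_idl.
Qed.

(** Both sides are algebra morphisms into a threefold composite algebra with the same restriction to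
    the unit; the two bracketings are identified by [vcomp_assoc_alg]. *)
Lemma free_comult_coassoc (f : VOb p) :
  free_comult (free_Lob f) ∘ free_comult f = vh_dom (free_Rmap (Sigma f)) ∘ free_comult f.
Proof.
have e1 : vh_cod (comult_ext (free_Lob f)) = vh_dom (@idm (V p) (free_Rob f)).
  exact: comult_ext_cod.
have e2 : vh_cod (free_Rmap (Sigma f)) = vh_dom (comult_ext f) by exact: free_Rmap_cod.
have h1 := IsAlgHom_comp (IsAlgHom_comp (comult_ext_alg f)
  (stack_alg e1 (comult_ext_alg (free_Lob f)) (IsAlgHom_id (free_str f))))
  (vcomp_assoc_alg (free_str (free_Lob (free_Lob f))) (free_str (free_Lob f)) (free_str f)).
have h2 := IsAlgHom_comp (comult_ext_alg f)
  (stack_alg e2 (free_Rmap_alg (Sigma f)) (comult_ext_alg f)).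
rewrite -[LHS]comp_idl.
apply: (f_equal vh_dom (free_eq h1 h2 _ _)).
- rewrite /= comp_idl -!comp_assoc -!/(free_comult _) !free_comult_L.
  by rewrite (free_Rmap_L (Sigma f)) /= comp_idr (free_comult_L (free_Lob f)).
- by rewrite /= !comult_ext_cod !comp_idl.
Qed.

Lemma free_comonad : IsComonad (Lcopoint free_ff) free_Sigma.
Proof.
split; last split; move=> f; apply: VHom_ext => /=; rewrite ?comp_idl //.
- exact: free_comult_counit.
- exact: free_comult_counit_fmap.
- exact: free_comult_coassoc.
Qed.

Definition free_lawfs : Lawfs p :=
  {| lw_ff := free_ff; lw_Sigma := free_Sigma; lw_Sigma_dom := fun f => eq_refl;
     lw_comonad := free_comonad |}.

(** * The monad structure and distributivity *)

Definition free_mult (f : VOb p) : VHom (free_Rob (free_Rob f)) (free_Rob f) :=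
  free_ext (free_str f) (@idm (V p) (free_Rob f)).

Lemma free_mult_alg (f : VOb p) : IsAlgHom (free_str (free_Rob f)) (free_str f) (free_mult f).
Proof. exact: free_ext_alg. Qed.

Lemma free_mult_cod (f : VOb p) : vh_cod (free_mult f) = idm _.
Proof. exact: free_ext_cod. Qed.

Lemma free_mult_L (f : VOb p) : vh_dom (free_mult f) ∘ fa_L (Phi (free_Rob f)) = idm _.
Proof. exact: free_ext_L. Qed.

Lemma free_Pi_nat (f g : VOb p) (t : VHom f g) :
  free_mult g • free_Rmap (free_Rmap t) = free_Rmap t • free_mult f.
Proof.
apply: (free_eq (IsAlgHom_comp (free_Rmap_alg _) (free_mult_alg _))
  (IsAlgHom_comp (free_mult_alg _) (free_Rmap_alg _))).
- by rewrite /= -!comp_assoc (free_Rmap_L (free_Rmap t)) (free_mult_L f) comp_assoc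
    (free_mult_L g) comp_idl comp_idr.
- by rewrite /= !free_mult_cod !free_Rmap_cod comp_idl comp_idr.
Qed.

Definition free_Pi : NatTrans (comp_functor (Rfun free_ff) (Rfun free_ff)) (Rfun free_ff).
Proof.
refine {| nt := fun f : V p => free_mult f
  : @Hom (V p) (comp_functor (Rfun free_ff) (Rfun free_ff) f) (Rfun free_ff f) |}.
move=> f g t.
rewrite -[fmap (comp_functor _ _) t]/(fmap (Rfun free_ff) (fmap (Rfun free_ff) t)).
by rewrite (free_Rmap_eq (fmap (Rfun free_ff) t)) (free_Rmap_eq t); exact: free_Pi_nat.
Defined.

Lemma free_monad : IsMonad (Rpoint free_ff) free_Pi.
Proof.
split; last split; move=> f.
- apply: VHom_ext => /=; [exact: (free_mult_L f) | by rewrite free_mult_cod comp_idl].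
- rewrite (free_Rmap_eq (Rpoint free_ff f)).
  apply: (free_eq (IsAlgHom_comp (free_Rmap_alg _) (free_mult_alg _)) (IsAlgHom_id _)).
  + by rewrite /= -comp_assoc (free_Rmap_L (Rpoint free_ff f)) /= comp_assoc
      (free_mult_L f) comp_idl.
  + by rewrite /= free_mult_cod free_Rmap_cod; exact: comp_idl.
- rewrite (free_Rmap_eq (free_Pi f)).
  apply: (free_eq (IsAlgHom_comp (free_mult_alg _) (free_mult_alg _))
    (IsAlgHom_comp (free_Rmap_alg _) (free_mult_alg _))).
  + by rewrite /= -!comp_assoc (free_mult_L (free_Rob f)) (free_Rmap_L (free_mult f))
      comp_assoc (free_mult_L f) comp_idl comp_idr.
  + by rewrite /= !free_mult_cod free_Rmap_cod free_mult_cod.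
Qed.

(** Both sides are algebra morphisms from the free algebra on [R' f] to [RL f]. The right-hand one
    can be stacked because the codomain component of [d] is the domain component of [free_mult f].
    This serves both the multiplication and the comultiplication law of distributivity. *)
Lemma free_comult_mu (f : VOb p) :
  free_comult f ∘ vh_dom (free_mult f)
  = vh_dom (free_mult (free_Lob f))
    ∘ vh_dom (free_Rmap (@canonical_LR_RL E B p free_lawfs _ free_monad f))
    ∘ free_comult (free_Rob f).
Proof.
set d : VHom (free_Lob (free_Rob f)) (free_Rob (free_Lob f)) :=
  @canonical_LR_RL E B p free_lawfs _ free_monad f.
have e : vh_cod (free_mult (free_Lob f) • free_Rmap d) = vh_dom (free_mult f).
  by rewrite /= free_mult_cod free_Rmap_cod comp_idl.
have h1 := IsAlgHom_comp (free_mult_alg f) (comult_ext_alg f).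
have h2 := IsAlgHom_comp (comult_ext_alg (free_Rob f))
  (stack_alg e (IsAlgHom_comp (free_Rmap_alg d) (free_mult_alg (free_Lob f))) (free_mult_alg f)).
apply: (f_equal vh_dom (free_eq h1 h2 _ _)).
- rewrite /= -!/(free_comult _) -!comp_assoc (free_mult_L f) (free_comult_L (free_Rob f))
    (free_Rmap_L d) comp_idr.
  by rewrite comp_assoc (free_mult_L (free_Lob f)) comp_idl.
- by rewrite /= !comult_ext_cod !free_mult_cod comp_idr.
Qed.

Definition free_awfs : Awfs p.
Proof.
refine (@Build_Awfs E B p free_lawfs free_Pi free_mult_cod free_monad _).
have [m1 [m2 m3]] := free_monad; have [c1 [c2 c3]] := free_comonad.
(* The components come in pairs, for compatibility with the unit, the multiplication, the counit and
   the comultiplication. *)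
split; [|split; [|split]] => f; apply: VHom_ext.
- exact: (free_comult_L f).
- exact: (f_equal vh_dom (m2 f)).
- exact: (free_comult_mu f).
- rewrite /= free_mult_cod comp_idl; exact: (eq_sym (f_equal vh_dom (m3 f))).
- exact: free_comult_counit_fmap.
- rewrite /=; have /= := vh_comm (free_mult f); rewrite free_mult_cod comp_idl; exact.
- rewrite /= comp_idr; exact: (eq_sym (free_comult_coassoc f)).
- exact: (free_comult_mu f).
Defined.

(** * The comparison of [R] with the free monad *)

Definition xi_map (f : VOb p) : Hom (ffK F f) (fa_K (Phi f)) :=
  free_str f ∘ fmap (ffK F) (free_unit f : @Hom (V p) _ _).

Lemma xi_L (f : VOb p) : xi_map f ∘ ffL F f = fa_L (Phi f).
Proof.
have /= e := nt_nat (ffL F) (free_unit f : @Hom (V p) _ _).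
by rewrite /xi_map -comp_assoc -e comp_assoc (as_L (free_str f)) comp_idl.
Qed.

Lemma xi_R (f : VOb p) : fa_R (Phi f) ∘ xi_map f = ffR F f.
Proof.
rewrite /xi_map comp_assoc (as_R (free_str f)).
by have /= -> := nt_nat (ffR F) (free_unit f : @Hom (V p) _ _); rewrite comp_idl.
Qed.

Lemma xi_vert (f : VOb p) : Vertical p (xi_map f).
Proof. by apply: Vertical_cancel (ffL_vert F f) _; rewrite xi_L; exact: fa_L_vert. Qed.

(** An algebra morphism carries [free_str f] to [a], so on the comparison map it is computed from
    its restriction to the unit. *)
Lemma alg_hom_xi (f g : VOb p) (a : AlgStr F g) (t : VHom (free_Rob f) g) :
  IsAlgHom (free_str f) a t -> vh_dom t ∘ xi_map f = a ∘ fmap (ffK F) (t • free_unit f).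
Proof. by move=> h; rewrite /xi_map comp_assoc h -comp_assoc fmap_comp. Qed.

Lemma xi_nat (f g : VOb p) (t : VHom f g) :
  xi_map g ∘ fmap (ffK F) (t : @Hom (V p) f g) = vh_dom (free_Rmap t) ∘ xi_map f.
Proof.
by rewrite (alg_hom_xi (free_Rmap_alg t)) free_ext_eta fmap_comp /xi_map comp_assoc.
Qed.

Definition xi_nt : NatTrans (ffK F) (ffK free_ff) :=
  {| nt := fun f : V p => xi_map f : Hom (ffK F f) (ffK free_ff f); nt_nat := xi_nat |}.

Definition xi_ff : FFHom F free_ff :=
  {| ffh := xi_nt; ffh_vert := xi_vert; ffh_L := xi_L; ffh_R := xi_R |}.

(** [comult_ext f] is an algebra morphism into a composite algebra, whose structure already contains
    [comult]; naturality then leaves a comparison of squares. *)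
Lemma xi_Sigma (f : VOb p) :
  free_comult f ∘ xi_map f
  = xi_map (free_Lob f) ∘ fmap (ffK F) (Lhom xi_ff f) ∘ comult F f.
Proof.
rewrite (alg_hom_xi (comult_ext_alg f)) free_ext_eta /= /comp_str_map /xi_map.
rewrite -!comp_assoc; f_equal; rewrite comult_nat !comp_assoc; f_equal.
rewrite -!fmap_comp; f_equal; apply: VHom_ext => /=; first by rewrite comp_idl comp_idr.
rewrite -comp_assoc; apply: eq_trans (eq_sym (comp_idl _)); f_equal.
rewrite -fmap_comp; f_equal; apply: VHom_ext => /=; last exact: comp_idl.
exact: (fa_factor (Phi (free_Lob f))).
Qed.

Definition xi : LawfsHom F free_awfs.
Proof.
refine (@Build_LawfsHom E B p F free_awfs xi_ff _).
move=> f; apply: VHom_ext => /=; last exact: xi_Sigma.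
by rewrite lw_Sigma_dom !comp_idl.
Defined.

(** * Monad algebras and algebraic freeness *)

Lemma palg_cod (A : PAlg (Rpoint F)) : vh_cod (pa_str A) = idm _.
Proof. by rewrite -[LHS]comp_idr; exact: (f_equal vh_cod (pa_unit A)). Qed.

Definition str_of_palg (A : PAlg (Rpoint F)) : AlgStr F (pa_ob A).
Proof.
refine (@Build_AlgStr E B p F (pa_ob A) (vh_dom (pa_str A)) _ _).
- exact: (f_equal vh_dom (pa_unit A)).
- by have /= := vh_comm (pa_str A); rewrite palg_cod comp_idl.
Defined.

Definition em_map (A : PAlg (Rpoint F)) : VHom (free_Rob (pa_ob A)) (pa_ob A) :=
  free_ext (str_of_palg A) (@idm (V p) (pa_ob A)).

Lemma em_cod (A : PAlg (Rpoint F)) : vh_cod (em_map A) = idm _.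
Proof. exact: free_ext_cod. Qed.

Lemma em_alg (A : PAlg (Rpoint F)) :
  IsAlgHom (free_str (pa_ob A)) (str_of_palg A) (em_map A).
Proof. exact: free_ext_alg. Qed.

Lemma em_L (A : PAlg (Rpoint F)) : vh_dom (em_map A) ∘ fa_L (Phi (pa_ob A)) = idm _.
Proof. exact: free_ext_L. Qed.

Lemma em_xi (A : PAlg (Rpoint F)) :
  vh_dom (em_map A) ∘ xi_map (pa_ob A) = str_of_palg A.
Proof. by rewrite (alg_hom_xi (em_alg A)) free_ext_eta fmap_id comp_idr. Qed.

Lemma palg_hom_alg (A A' : PAlg (Rpoint F)) (t : PAlgHom A A') :
  IsAlgHom (str_of_palg A) (str_of_palg A') (ph_map t).
Proof. exact: (f_equal vh_dom (ph_comm t)). Qed.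

Lemma em_unit (A : PAlg (Rpoint F)) :
  em_map A • Rpoint free_ff (pa_ob A) = @idm (V p) (pa_ob A).
Proof. by apply: VHom_ext => /=; [exact: em_L | rewrite em_cod comp_idl]. Qed.

Lemma em_assoc (A : PAlg (Rpoint F)) :
  em_map A • free_mult (pa_ob A) = em_map A • @fmap _ _ (Rfun free_ff) _ _ (em_map A).
Proof.
rewrite free_Rmap_eq.
apply: (free_eq (IsAlgHom_comp (free_mult_alg _) (em_alg A))
  (IsAlgHom_comp (free_Rmap_alg (em_map A)) (em_alg A))).
- by rewrite /= -!comp_assoc (free_mult_L (pa_ob A)) (free_Rmap_L (em_map A)) comp_assoc em_L
    comp_idl comp_idr.
- by rewrite /= free_mult_cod free_Rmap_cod em_cod.
Qed.

Lemma em_nat (A A' : PAlg (Rpoint F)) (t : PAlgHom A A') :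
  ph_map t • em_map A = em_map A' • @fmap _ _ (Rfun free_ff) _ _ (ph_map t).
Proof.
rewrite free_Rmap_eq.
apply: (free_eq (IsAlgHom_comp (em_alg A) (palg_hom_alg t))
  (IsAlgHom_comp (free_Rmap_alg (ph_map t)) (em_alg A'))).
- by rewrite /= -!comp_assoc em_L (free_Rmap_L (ph_map t)) comp_assoc em_L comp_idl comp_idr.
- by rewrite /= free_Rmap_cod !em_cod comp_idl comp_idr.
Qed.

(** The multiplication restricts to an identity along the unit; thus the free structure is recovered
    from monad data. *)
Lemma free_str_xi (f : VOb p) : vh_dom (free_mult f) ∘ xi_map (free_Rob f) = free_str f.
Proof. by rewrite (alg_hom_xi (free_mult_alg f)) free_ext_eta fmap_id comp_idr. Qed.

(** Associativity and the condition on [xi_map] make [b] an algebra morphism out of the free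
    algebra; like [em_map A], it restricts to the identity along the unit. *)
Lemma em_map_unique (A : PAlg (Rpoint F)) (b : VHom (free_Rob (pa_ob A)) (pa_ob A)) :
  b • free_unit (pa_ob A) = @idm (V p) (pa_ob A) ->
  b • free_mult (pa_ob A) = b • free_Rmap b ->
  vh_dom b ∘ xi_map (pa_ob A) = str_of_palg A -> em_map A = b.
Proof.
move=> u m x.
have hb : IsAlgHom (free_str (pa_ob A)) (str_of_palg A) b.
  rewrite /IsAlgHom -free_str_xi comp_assoc.
  have /= -> := f_equal vh_dom m.
  by rewrite -comp_assoc -xi_nat comp_assoc x.
apply: (free_eq (em_alg A) hb).
- by rewrite em_L; exact: (eq_sym (f_equal vh_dom u)).
- by rewrite em_cod -[RHS]comp_idr; exact: (eq_sym (f_equal vh_cod u)).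
Qed.

Theorem free_awfs_algebraically_free : IsAlgebraicallyFreeOn free_awfs F.
Proof.
exists xi; refine (@induced_iso (V p) (Rfun F) (Rfun free_ff) (Rpoint F) (Rpoint free_ff)
  free_Pi (Rhom xi_ff) (Rhom_point xi_ff) em_map em_unit em_assoc em_nat _ _).
- by move=> A; apply: VHom_ext; [exact: em_xi | rewrite /= em_cod palg_cod comp_idl].
- case=> [[g b u] a]; apply: em_map_unique.
  + by apply: eq_trans (u); exact: VHom_ext.
  + by rewrite -free_Rmap_eq; exact: a.
  + by [].
Qed.

End FreeAwfs.

(** * Base change of vertical maps along maps of the total category *)

Section BaseChange.
Context (E B : Category) (p : Functor E B) (cl : Cleavage p).
Context (Hpb : forall I : B, HasPullbacks (Fibre p I)).

(** The universal property is only required for vertical maps over [p Y]. *)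
Definition IsBaseChange (W : VOb p) (Y : E) (v : Hom Y (vcod W))
  (P : SliceOb (base_ob p Y)) (q : Hom (fib_ob (sl_ob P)) (vdom W)) : Prop :=
  vmap W ∘ q = v ∘ fh_map (sl_map P) /\
  forall (T : Fibre p (p Y)) (x : Hom (fib_ob T) (vdom W))
    (y : @Hom (Fibre p (p Y)) T (base_ob p Y)), vmap W ∘ x = v ∘ fh_map y ->
  exists! w : @Hom (Fibre p (p Y)) T (sl_ob P),
    q ∘ fh_map w = x /\ sl_map P ∘ w = y.

(** Reindex [W] along the base map [u] of [v], factor [v] through the cartesian lift, and pull back
    inside the fibre over [p Y]. *)
Lemma base_change_exists (W : VOb p) (Y : E) (v : Hom Y (vcod W)) :
  exists (P : SliceOb (base_ob p Y)) (q : Hom (fib_ob (sl_ob P)) (vdom W)),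
    IsBaseChange v q.
Proof.
have [u ou] := Over_ex v eq_refl (fib_eq (fib_cod W)).
have [yv [[oy ly] _]] := cartesian_over (lift_cartesian cl u (fib_cod W))
  (lift_over cl u (fib_cod W)) ou (comp_idr u).
have [oW lW] := the_spec (vreindex_unique cl u).
set Wu := the _ in oW lW.
pose Wf := @Build_FibHom E B p (p Y) (reindex cl u (fib_dom W))
  (reindex cl u (fib_cod W)) Wu oW.
pose yf := @Build_FibHom E B p (p Y) (base_ob p Y) (reindex cl u (fib_cod W)) yv oy.
have [P [p1 [p2 [ePB uPB]]]] :=
  Hpb (Wf : @Hom (Fibre p (p Y)) _ _) (yf : @Hom (Fibre p (p Y)) _ _).
exists (@Build_SliceOb (Fibre p (p Y)) (base_ob p Y) P p2).
exists (lift cl u (fib_dom W) ∘ fh_map p1); split.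
  have /= e := f_equal fh_map ePB.
  by rewrite /= comp_assoc -lW -comp_assoc e comp_assoc ly.
move=> T x y exy.
have ow : Over p (vmap W ∘ x) u by rewrite exy; exact: Over_idr (fh_over y) ou.
(* Since [vmap W] is vertical, [x] lies over the same map as [vmap W ∘ x]. *)
have ox : Over p x u.
  have [w oxw] := Over_ex x (fib_eq T) (fib_eq (fib_dom W)).
  have -> : u = w; last by [].
  apply: HomEq_eq; apply: Over_eq ow _ _ _ _.
  exact: Over_idl oxw (Vertical_over (vvert W) eq_refl).
have [x' [[ox' lx'] ux']] := cartesian_over (lift_cartesian cl u (fib_dom W))
  (lift_over cl u (fib_dom W)) ox (comp_idr u).
pose xf := @Build_FibHom E B p (p Y) T (reindex cl u (fib_dom W)) x' ox'.
have exf : @comp (Fibre p (p Y)) _ _ _ Wf xf = @comp (Fibre p (p Y)) _ _ _ yf y.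
{ apply: FibHom_ext.
  apply: (exists_unique_eq (cartesian_over (lift_cartesian cl u (fib_cod W))
    (lift_over cl u (fib_cod W)) ow (comp_idr u))).
  - by split; [exact: Over_idl ox' oW | rewrite /= comp_assoc lW -comp_assoc lx'].
  - by split; [exact: Over_idl (fh_over y) oy | rewrite /= comp_assoc ly]. }
have [w [[w1 w2] uw]] := uPB _ _ _ exf.
exists w; split.
  by split => //; have /= e := f_equal fh_map w1; rewrite -comp_assoc e.
move=> w' [e1 e2]; apply: uw; split => //.
apply: FibHom_ext => /=; apply: eq_sym; apply: ux'; split; first exact: (fh_over (p1 ∘ w')).
by rewrite comp_assoc.
Qed.

Lemma base_change_eq (W : VOb p) (Y : E) (v : Hom Y (vcod W))
  (P : SliceOb (base_ob p Y)) (q : Hom (fib_ob (sl_ob P)) (vdom W))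
  (H : IsBaseChange v q) (T : Fibre p (p Y)) (w w' : @Hom (Fibre p (p Y)) T (sl_ob P)) :
  q ∘ fh_map w = q ∘ fh_map w' -> sl_map P ∘ w = sl_map P ∘ w' -> w = w'.
Proof.
case: H => e u e1 e2.
have e' : vmap W ∘ (q ∘ fh_map w') = v ∘ fh_map (sl_map P ∘ w').
  by rewrite /= !comp_assoc e.
exact: (exists_unique_eq (u _ _ _ e')).
Qed.

End BaseChange.

(** * Free algebras from initial algebras *)

Section FreeFromInitial.
Context (E B : Category) (p : Functor E B) (cl : Cleavage p).
Context (Hpb : forall I : B, HasPullbacks (Fibre p I)).
Context (F : FunctorialFactorisation p) (f : VOb p).
Local Notation Y := (vcod f).
Local Notation Fib := (Fibre p (p Y)).
Context (cp : BinaryCoproducts Fib).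
Local Notation fs := (vertical_slice (vvert f)).
Local Notation "b • a" := (@comp (V p) _ _ _ b a) (at level 40, left associativity).

Lemma AlgStr_over (g : SliceOb (base_ob p Y)) (a : AlgStr F (slice_V g)) :
  Over p a (idm (p Y)).
Proof.
apply: Vertical_over (fib_eq (slice_K F g)).
apply: Vertical_cancel (ffL_vert F (slice_V g)) _.
by rewrite as_L; exact: Vertical_idm.
Qed.

Definition AlgStr_fib (g : SliceOb (base_ob p Y)) (a : AlgStr F (slice_V g)) :
  @Hom Fib (slice_K F g) (sl_ob g) :=
  @Build_FibHom E B p (p Y) (slice_K F g) (sl_ob g) a (AlgStr_over a).

(** An algebra for the coproduct endofunctor amounts to a map from [f] over [Y] and an [R]-algebra
    structure; [under_inl] and [under_str] take it apart again. *)
Definition coproduct_alg (g : SliceOb (base_ob p Y)) (x : @Hom Fib (sl_ob fs) (sl_ob g))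
  (ex : sl_map g ∘ x = sl_map fs) (a : AlgStr F (slice_V g)) :
  PAlg (coproduct_point F cp fs).
Proof.
unshelve refine (@Build_PAlgOb _ _ (coproduct_point F cp fs) g
  (@Build_SliceHom _ _ (coproduct_ob F cp fs g) g (copair cp x (AlgStr_fib a)) _) _).
- change (sl_map g ∘ copair cp x (AlgStr_fib a) = copair cp (sl_map fs) (slice_R F g)).
  by rewrite copair_post ex; f_equal; apply: FibHom_ext; exact: (as_R a).
- apply: SliceHom_ext.
  change (copair cp x (AlgStr_fib a) ∘ (cop_inr cp _ _ ∘ slice_L F g) = idm (sl_ob g)).
  by rewrite comp_assoc copair_inr; apply: FibHom_ext; exact: (as_L a).
Defined.

Section Underlying.
Context (A : PAlg (coproduct_point F cp fs)).
Local Notation g := (pa_ob A : SliceOb (base_ob p Y)).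
Let str : @Hom Fib (cop cp (sl_ob fs) (slice_K F g)) (sl_ob g) := sh_map (pa_str A).

Lemma under_comm : sl_map g ∘ str = copair cp (sl_map fs) (slice_R F g).
Proof. exact: (sh_comm (pa_str A)). Qed.

Definition under_inl : @Hom Fib (sl_ob fs) (sl_ob g) := str ∘ cop_inl cp _ _.

Lemma under_inl_comm : sl_map g ∘ under_inl = sl_map fs.
Proof. by rewrite comp_assoc under_comm copair_inl. Qed.

Lemma under_inr_L : str ∘ cop_inr cp _ _ ∘ slice_L F g = idm (sl_ob g).
Proof. by rewrite -comp_assoc; exact: (f_equal sh_map (pa_unit A)). Qed.

Definition under_str : AlgStr F (slice_V g).
Proof.
refine (@Build_AlgStr E B p F (slice_V g) (fh_map (str ∘ cop_inr cp _ _)) _ _).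
- exact: (f_equal fh_map under_inr_L).
- change (fh_map (sl_map g ∘ (str ∘ cop_inr cp _ _)) = fh_map (slice_R F g)).
  by rewrite comp_assoc under_comm copair_inr.
Defined.

Lemma under_str_fib : AlgStr_fib under_str = str ∘ cop_inr cp _ _.
Proof. exact: FibHom_ext. Qed.

End Underlying.

Section Extension.
Context (A : PAlg (coproduct_point F cp fs)) (HA : IsInitial A).
Local Notation g := (pa_ob A : SliceOb (base_ob p Y)).
Context (W : VOb p) (b : AlgStr F W) (h : VHom f W).

Lemma under_unit_comm : vmap (slice_V g) ∘ fh_map (under_inl A) = idm Y ∘ vmap f.
Proof. by rewrite comp_idl; exact: (f_equal fh_map (under_inl_comm A)). Qed.

Definition under_unit : VHom f (slice_V g) :=
  @Build_VHom E B p f (slice_V g) (fh_map (under_inl A)) (idm Y) under_unit_comm.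

(** Base change along [vh_cod h] moves the problem into the slice over [Y]. Morphisms into the
    pulled-back algebra correspond to algebra squares into [W] extending [h], so initiality gives
    exactly one. *)
Lemma under_extension :
  exists! t : VHom (slice_V g) W, IsAlgHom (under_str A) b t /\ t • under_unit = h.
Proof.
have [P [q H]] := base_change_exists cl Hpb (vh_cod h).
have Hq := proj1 H.
pose Q := @Build_VHom E B p (slice_V P) W q (vh_cod h) Hq.
have e1 : vmap W ∘ (b ∘ fmap (ffK F) (Q : @Hom (V p) _ _)) = vh_cod h ∘ fh_map (slice_R F P).
  by rewrite comp_assoc as_R; exact: (nt_nat (ffR F) (Q : @Hom (V p) _ _)).
(* The structure [b] pulls back to [P]: [a] is induced by [b] after [K] of [Q], together with
   [slice_R F P]. *)
have [a [[a1 a2] _]] := proj2 H (slice_K F P) _ _ e1.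
have aL : a ∘ slice_L F P = idm (sl_ob P).
{ apply: (base_change_eq H).
  - rewrite /= comp_assoc a1 -comp_assoc.
    have /= <- := nt_nat (ffL F) (Q : @Hom (V p) _ _).
    by rewrite comp_assoc as_L comp_idl comp_idr.
  - by rewrite comp_assoc a2 comp_idr slice_LR. }
pose aP := @Build_AlgStr E B p F (slice_V P) (fh_map a)
  (f_equal fh_map aL) (f_equal fh_map a2).
have [x [[x1 x2] _]] := proj2 H (sl_ob fs) (vh_dom h) (sl_map fs) (vh_comm h).
pose PA := coproduct_alg x2 aP.
have aPE : AlgStr_fib aP = a by exact: FibHom_ext.
(* A slice map is an algebra morphism exactly when the two coproduct injections agree on it: the
   left one says that it extends [h], the right one that it respects the [R]-structures. *)
have char (t : @Hom (Slice (base_ob p Y : Fib)) g P) :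
    t ∘ pa_str A = pa_str PA ∘ fmap (coproduct_endofunctor F cp fs) t
    <-> IsAlgHom (under_str A) b (Q • slice_VHom t) /\ (Q • slice_VHom t) • under_unit = h.
{ have tP : sl_map P ∘ sh_map t = sl_map g by exact: (sh_comm t).
  have hx : sh_map t ∘ under_inl A = x <-> (Q • slice_VHom t) • under_unit = h.
  { split=> e.
    - apply: VHom_ext; last by rewrite /= !comp_idr.
      by rewrite /= -comp_assoc; rewrite -x1 -e.
    - apply: (base_change_eq H); last by rewrite comp_assoc tP under_inl_comm x2.
      by rewrite x1 -e /= comp_assoc. }
  have ha : sh_map t ∘ AlgStr_fib (under_str A) = a ∘ slice_Kmap F t
      <-> IsAlgHom (under_str A) b (Q • slice_VHom t).
  { have e3 : b ∘ fmap (ffK F) (Q • slice_VHom t) = q ∘ fh_map (a ∘ slice_Kmap F t).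
      by rewrite fmap_comp comp_assoc -a1 -comp_assoc.
    have e3' : vh_dom (Q • slice_VHom t) ∘ under_str A
        = q ∘ fh_map (sh_map t ∘ AlgStr_fib (under_str A)) by rewrite /= -comp_assoc.
    rewrite /IsAlgHom e3 e3'; split=> [-> // | e].
    refine (base_change_eq H (w := sh_map t ∘ AlgStr_fib (under_str A))
      (w' := a ∘ slice_Kmap F t) e _).
    rewrite !comp_assoc tP a2 slice_Kmap_R; apply: FibHom_ext; exact: (as_R (under_str A)). }
  rewrite -hx -ha; split=> [e | [e4 e5]].
  - have e' : sh_map t ∘ sh_map (pa_str A)
        = copair cp x (AlgStr_fib aP) ∘ coproduct_mor F cp fs t by exact: (f_equal sh_map e).
    split.
    + rewrite under_str_fib comp_assoc e' -comp_assoc.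
      by rewrite /coproduct_mor copair_inr comp_assoc copair_inr aPE.
    + rewrite /under_inl comp_assoc e' -comp_assoc.
      by rewrite /coproduct_mor !copair_inl.
  - apply: SliceHom_ext.
    change (sh_map t ∘ sh_map (pa_str A)
      = copair cp x (AlgStr_fib aP) ∘ coproduct_mor F cp fs t).
    apply: cop_ext; rewrite -!comp_assoc /coproduct_mor.
    + by rewrite !copair_inl; exact: e5.
    + by rewrite copair_inr -under_str_fib e4 comp_assoc copair_inr aPE. }
have [t [_ ut]] := HA PA.
exists (Q • slice_VHom (ph_map t)); split; first by apply/char; exact: (ph_comm t).
move=> t' [t1 t2].
have t'cod : vh_cod t' = vh_cod h.
  by rewrite -t2; exact: (eq_sym (comp_idr _)).
have e2 : vmap W ∘ vh_dom t' = vh_cod h ∘ fh_map (sl_map g).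
  by rewrite -t'cod; exact: (vh_comm t').
(* A competing square has codomain component [vh_cod h], so it factors through the base change, and
   initiality applies to the factor. *)
have [w [[w1 w2] _]] := proj2 H (sl_ob g) _ _ e2.
pose w' : @Hom (Slice (base_ob p Y : Fib)) g P := @Build_SliceHom _ _ g P w w2.
have et' : Q • slice_VHom w' = t' by apply: VHom_ext => //=; rewrite comp_idr.
have ew : w' ∘ pa_str A = pa_str PA ∘ fmap (coproduct_endofunctor F cp fs) w'.
  by apply/char; rewrite et'.
by rewrite (ut (@Build_PAlgHom _ _ (coproduct_point F cp fs) A PA w' ew) I).
Qed.
End Extension.

Definition free_of_initial (A : PAlg (coproduct_point F cp fs)) (HA : IsInitial A) :
  FreeAlgebra F f.
Proof.
refine (@Build_FreeAlgebra E B p F f (fib_ob (sl_ob (pa_ob A))) (fh_map (under_inl A))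
  (ex_intro _ (p Y) (fh_over (under_inl A))) _ (vvert (slice_V (pa_ob A)))
  (f_equal fh_map (under_inl_comm A)) (under_str A) _).
move=> W b h.
have [t [[t1 t2] ut]] := under_extension HA b h.
exists t; split.
  by split=> //; rewrite -t2; f_equal; exact: VHom_ext.
move=> t' [e1 e2]; apply: ut; split=> //.
by rewrite -e2; f_equal; exact: VHom_ext.
Defined.

End FreeFromInitial.

Theorem corollary5p4p7 (E B : Category) (p : Functor E B)
  (Hbif : IsBifibration p)
  (cl : Cleavage p)
  (Hls : IsLocallySmall cl)
  (HB : HasFiniteLimits B)
  (Hpb : forall I : B, HasPullbacks (Fibre p I))
  (Hpo : forall I : B, HasPushouts (Fibre p I))
  (cp : forall I : B, BinaryCoproducts (Fibre p I))
  (m : V p)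
  (S : StepOne cl m)
  (Hinit : forall (X Y : E) (f : Hom X Y) (Hf : Vertical p f),
    exists A : PAlg (coproduct_point (step_one S) (cp (p Y)) (vertical_slice Hf)),
      IsInitial A) :
  exists A : Awfs p, IsCofibrantlyGenerated S A.
Proof.
(* Initial algebras are given by mere existence, whereas the factorisation needs a chosen one for
   every [f]. *)
pose Phi (f : VOb p) : FreeAlgebra (step_one S) f :=
  let A := constructive_indefinite_description _ (Hinit _ _ _ (vvert f)) in
  free_of_initial cl Hpb (proj2_sig A).
exists (free_awfs Phi); exact: free_awfs_algebraically_free.
Qed.
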